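(* Let $\mathbb{F}$ be a field, $\alpha$ a short root and $\theta\in U_\alpha\setminus\{1\}$, acting on the split building $\Delta_\Phi(\mathbb{F})$. (i) If $\Phi=\mathsf{F}_4$ then $\theta$ is type preserving with $\mathrm{Type}(\theta)=\{1,4\}$ if $\mathrm{char}(\mathbb{F})\neq2$ and $\mathrm{Type}(\theta)=\{4\}$ if $\mathrm{char}(\mathbb{F})=2$. (ii) If $\Phi=\mathsf{G}_2$ then $\mathrm{Type}(\theta)=S=\{1,2\}$ if $\mathrm{char}(\mathbb{F})\neq3$ and $\mathrm{Type}(\theta)=\{1\}$ if $\mathrm{char}(\mathbb{F})=3$.
   Context: Bourbaki labelling ($\alpha_3,\alpha_4$ short in $\mathsf{F}_4$; $\alpha_1$ short in $\mathsf{G}_2$). $U_\alpha=\{x_\alpha(a):a\in\mathbb{F}\}$ root subgroup of the Chevalley group. $\mathrm{Type}(\theta)$ is the union of types of simplices of $\Delta$ mapped by $\theta$ onto opposite simplices (simplices of type $J$ = cosets of $P_{S\setminus J}$; opposite = opposite types and contained in chambers at Weyl distance $w_0$). *)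

(* Defs.v *)
(* The split building of type F4 / G2 over a field F, realised as the        *)
(* coset geometry of the (adjoint = simply connected, for F4 and G2)         *)
(* Chevalley group G_Phi(F), constructed following Chevalley from the        *)
(* adjoint representation on L_Z (x) F, L_Z the Z-span of a Chevalley basis. *)
From HB Require Import structures.
From mathcomp Require Import all_boot all_order all_algebra.
Set Implicit Arguments.
Unset Strict Implicit.
Unset Printing Implicit Defensive.
Import GRing.Theory Num.Theory.
Local Open Scope ring_scope.

Record rootdata := RootData {
  rk : nat;                       (* rank; simple roots indexed 0 .. rk-1 *)
  nroots : nat;
  bform : seq (seq int);          (* Gram matrix (alpha_i, alpha_j) of simple roots (scaled) *)
  rts : seq (seq int);            (* roots as coefficient vectors on the simple roots *)
  ntab : seq (nat * nat * int);   (* structure constants N_{a,b} of a Chevalley basis *)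
  w0word : seq nat                (* a reduced word for the longest element w0 *)
}.

Section RootSystem.
Variable D : rootdata.

(** dimension of the Lie algebra: basis e_a (a < nroots), then h_i (i < rk) *)
Definition ldim := (nroots D + rk D)%N.

Definition rootv (a : nat) : seq int := nth [::] (rts D) a.
Definition rcoef (a i : nat) : int := nth 0 (rootv a) i.
Definition unitv (i : nat) : seq int := mkseq (fun j => (i == j)%:Z) (rk D).

Definition bil (u v : seq int) : int :=
  \sum_(i < rk D) \sum_(j < rk D)
     nth 0 u i * nth 0 (nth [::] (bform D) i) j * nth 0 v j.
Definition rnorm (a : nat) : int := bil (rootv a) (rootv a).
Definition snorm (i : nat) : int := bil (unitv i) (unitv i).

(** Cartan integer <beta, alpha_i^vee> = 2 (beta, alpha_i) / (alpha_i, alpha_i) *)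
Definition pairing (b i : nat) : int := ((2 * bil (rootv b) (unitv i)) %/ snorm i)%Z.
(** coefficient of h_i in the coroot h_a = a^vee = 2a/(a,a) = sum_i c_i alpha_i^vee *)
Definition corootc (a i : nat) : int := ((rcoef a i * snorm i) %/ rnorm a)%Z.

(** index of a vector among the roots (nroots D if it is not a root) *)
Definition rindex (v : seq int) : nat := index v (rts D).
Definition vadd (u v : seq int) : seq int := mkseq (fun i => nth 0 u i + nth 0 v i) (rk D).
Definition vopp (u : seq int) : seq int := mkseq (fun i => - nth 0 u i) (rk D).

Definition is_root (a : nat) : Prop := (a < nroots D)%N.
Definition positive (a : nat) : Prop := is_root a /\ (forall i, (i < rk D)%N -> 0 <= rcoef a i).
Definition neg (a : nat) : nat := rindex (vopp (rootv a)).
Definition simple (i : nat) : nat := rindex (unitv i).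
Definition short (a : nat) : Prop :=
  is_root a /\ exists b, is_root b /\ rnorm a < rnorm b.

(** structure constant N_{a,b} (with [e_a, e_b] = N_{a,b} e_{a+b} when a+b is a root) *)
Definition Nc (a b : nat) : int :=
  head 0 [seq x.2 | x <- ntab D & (x.1.1 == a) && (x.1.2 == b)].

(** ad(e_a) on the Chevalley basis (e_b)_b, (h_i)_i, as an integer matrix:
    column j = coordinates of [e_a, basis_j].
    [e_a, e_b] = N_{a,b} e_{a+b} if a+b is a root, = h_a if b = -a, 0 otherwise;
    [e_a, h_i] = - <a, alpha_i^vee> e_a. *)
Definition adZ (a : nat) : 'M[int]_ldim :=
  \matrix_(k < ldim, j < ldim)
    if (j < nroots D)%N then
      let v := vadd (rootv a) (rootv j) in
      if v == nseq (rk D) 0 then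
        (if (nroots D <= k)%N then corootc a (k - nroots D) else 0)
      else if (k < nroots D)%N && (k == rindex v :> nat) then Nc a j else 0
    else if k == a :> nat then - pairing a (j - nroots D) else 0.

(** divided powers ad(e_a)^n / n!, integral by Chevalley's theorem *)
Definition adpowZ (a n : nat) : 'M[int]_ldim :=
  map_mx (fun z => (z %/ (n`!)%:Z)%Z) (iter n (mulmx (adZ a)) 1%:M).
End RootSystem.

Section Chevalley.
Variables (F : fieldType) (D : rootdata).
Local Notation M := 'M[F]_(ldim D).

Inductive gen (X : M -> Prop) : M -> Prop :=
| gen1 : gen X 1%:M
| genM x y : X x -> gen X y -> gen X (x *m y)
| genV x y : X x -> gen X y -> gen X (invmx x *m y).

(** root element x_a(t) = exp(t ad e_a) = sum_n t^n ad(e_a)^n/n!  (ad e_a is nilpotent) *)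
Definition xr (a : nat) (t : F) : M :=
  \sum_(n < ldim D) t ^+ n *: map_mx (fun z : int => z%:~R) (adpowZ D a n).

Definition rootsub (a : nat) (g : M) : Prop := exists t : F, g = xr a t.

Definition chev : M -> Prop := gen (fun g => exists a, is_root D a /\ rootsub a g).

Definition wr (a : nat) (t : F) : M := xr a t *m xr (neg D a) (- t^-1) *m xr a t.
Definition hr (a : nat) (t : F) : M := wr a t *m invmx (wr a 1).

Definition borel_gen (g : M) : Prop :=
  (exists a, positive D a /\ rootsub a g) \/
  (exists (i : 'I_(rk D)) (t : F), t != 0 /\ g = hr (simple D i) t).
Definition borel : M -> Prop := gen borel_gen.

Definition parab (K : {set 'I_(rk D)}) : M -> Prop :=
  gen (fun g => borel_gen g \/ exists k : 'I_(rk D), k \in K /\ rootsub (neg D (simple D k)) g).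

Definition n0 : M := foldr (fun i m => wr (simple D i) 1 *m m) 1%:M (w0word D).

(** chambers gB, hB are opposite (Weyl distance w0) iff g^-1 h in B n0 B *)
Definition opp_chambers (g h : M) : Prop :=
  exists b1 b2, borel b1 /\ borel b2 /\ invmx g *m h = b1 *m n0 *m b2.

(** A simplex of type J is a coset g P_{S \ J}. The simplices g P_{S\J}
    and h P_{S\J} (of the same, self-opposite, type J: w0 = -1 here) are opposite
    iff they lie in chambers at Weyl distance w0. *)
Definition opp_simplices (J : {set 'I_(rk D)}) (g h : M) : Prop :=
  exists p q, parab (~: J) p /\ parab (~: J) q /\ opp_chambers (g *m p) (h *m q).

(** Type(theta): union of the types of the simplices mapped by theta onto
    opposite simplices, as a predicate on S = 'I_(rk D). *)
Definition Type_of (theta : M) (i : 'I_(rk D)) : Prop :=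
  exists (J : {set 'I_(rk D)}) (g : M),
    i \in J /\ chev g /\ opp_simplices J g (theta *m g).
End Chevalley.

(** ** Data for type F4 (Bourbaki labelling; simple root i of the paper is index i-1 here). *)

Definition F4_form : seq (seq int) := [:: [:: (4); (-2); (0); (0)]; [:: (-2); (4); (-2); (0)]; [:: (0); (-2); (2); (-1)]; [:: (0); (0); (-1); (2)]]%Z.

(** The roots, as coefficient vectors w.r.t. the simple roots:
    positive roots by increasing height, then their negatives in the same order. *)
Definition F4_roots : seq (seq int) := [::
    [:: (0); (0); (0); (1)];
    [:: (0); (0); (1); (0)];
    [:: (0); (1); (0); (0)];
    [:: (1); (0); (0); (0)];
    [:: (0); (0); (1); (1)];
    [:: (0); (1); (1); (0)];
    [:: (1); (1); (0); (0)];
    [:: (0); (1); (1); (1)];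
    [:: (0); (1); (2); (0)];
    [:: (1); (1); (1); (0)];
    [:: (0); (1); (2); (1)];
    [:: (1); (1); (1); (1)];
    [:: (1); (1); (2); (0)];
    [:: (0); (1); (2); (2)];
    [:: (1); (1); (2); (1)];
    [:: (1); (2); (2); (0)];
    [:: (1); (1); (2); (2)];
    [:: (1); (2); (2); (1)];
    [:: (1); (2); (2); (2)];
    [:: (1); (2); (3); (1)];
    [:: (1); (2); (3); (2)];
    [:: (1); (2); (4); (2)];
    [:: (1); (3); (4); (2)];
    [:: (2); (3); (4); (2)];
    [:: (0); (0); (0); (-1)];
    [:: (0); (0); (-1); (0)];
    [:: (0); (-1); (0); (0)];
    [:: (-1); (0); (0); (0)];
    [:: (0); (0); (-1); (-1)];
    [:: (0); (-1); (-1); (0)];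
    [:: (-1); (-1); (0); (0)];
    [:: (0); (-1); (-1); (-1)];
    [:: (0); (-1); (-2); (0)];
    [:: (-1); (-1); (-1); (0)];
    [:: (0); (-1); (-2); (-1)];
    [:: (-1); (-1); (-1); (-1)];
    [:: (-1); (-1); (-2); (0)];
    [:: (0); (-1); (-2); (-2)];
    [:: (-1); (-1); (-2); (-1)];
    [:: (-1); (-2); (-2); (0)];
    [:: (-1); (-1); (-2); (-2)];
    [:: (-1); (-2); (-2); (-1)];
    [:: (-1); (-2); (-2); (-2)];
    [:: (-1); (-2); (-3); (-1)];
    [:: (-1); (-2); (-3); (-2)];
    [:: (-1); (-2); (-4); (-2)];
    [:: (-1); (-3); (-4); (-2)];
    [:: (-2); (-3); (-4); (-2)]]%Z.

(** Structure constants of a Chevalley basis: (a, b, N) means [e_a, e_b] = N e_(a+b). *)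
Definition F4_Ntab : seq (nat * nat * int) := [::
    (0, 1, (-1)%Z); (0, 5, (-1)%Z); (0, 8, (-1)%Z); (0, 9, (-1)%Z); (0, 10, (2)%Z); (0, 12, (-1)%Z);
    (0, 14, (2)%Z); (0, 15, (-1)%Z); (0, 17, (2)%Z); (0, 19, (1)%Z); (0, 28, (1)%Z); (0, 31, (1)%Z);
    (0, 34, (2)%Z); (0, 35, (1)%Z); (0, 37, (-1)%Z); (0, 38, (2)%Z); (0, 40, (-1)%Z); (0, 41, (2)%Z);
    (0, 42, (-1)%Z); (0, 44, (-1)%Z); (1, 0, (1)%Z); (1, 2, (-1)%Z); (1, 5, (2)%Z); (1, 6, (-1)%Z);
    (1, 7, (1)%Z); (1, 9, (2)%Z); (1, 11, (1)%Z); (1, 17, (1)%Z); (1, 18, (1)%Z); (1, 20, (2)%Z);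
    (1, 28, (-1)%Z); (1, 29, (2)%Z); (1, 32, (-1)%Z); (1, 33, (2)%Z); (1, 34, (-1)%Z); (1, 36, (-1)%Z);
    (1, 38, (-1)%Z); (1, 43, (-1)%Z); (1, 44, (-2)%Z); (1, 45, (-1)%Z); (2, 1, (1)%Z); (2, 3, (-1)%Z);
    (2, 4, (1)%Z); (2, 12, (1)%Z); (2, 14, (1)%Z); (2, 16, (1)%Z); (2, 21, (1)%Z); (2, 29, (-1)%Z);
    (2, 30, (1)%Z); (2, 31, (-1)%Z); (2, 39, (-1)%Z); (2, 41, (-1)%Z); (2, 42, (-1)%Z); (2, 46, (-1)%Z);
    (3, 2, (1)%Z); (3, 5, (1)%Z); (3, 7, (1)%Z); (3, 8, (1)%Z); (3, 10, (1)%Z); (3, 13, (1)%Z);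
    (3, 22, (1)%Z); (3, 30, (-1)%Z); (3, 33, (-1)%Z); (3, 35, (-1)%Z); (3, 36, (-1)%Z); (3, 38, (-1)%Z);
    (3, 40, (-1)%Z); (3, 47, (-1)%Z); (4, 2, (-1)%Z); (4, 5, (1)%Z); (4, 6, (-1)%Z); (4, 7, (-2)%Z);
    (4, 9, (1)%Z); (4, 11, (-2)%Z); (4, 15, (-1)%Z); (4, 17, (1)%Z); (4, 19, (2)%Z); (4, 24, (1)%Z);
    (4, 25, (-1)%Z); (4, 31, (2)%Z); (4, 34, (-1)%Z); (4, 35, (2)%Z); (4, 37, (1)%Z); (4, 38, (-1)%Z);
    (4, 40, (1)%Z); (4, 43, (2)%Z); (4, 44, (-1)%Z); (4, 45, (-1)%Z); (5, 0, (1)%Z); (5, 1, (-2)%Z);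
    (5, 3, (-1)%Z); (5, 4, (-1)%Z); (5, 9, (2)%Z); (5, 11, (1)%Z); (5, 14, (-1)%Z); (5, 16, (-1)%Z);
    (5, 20, (2)%Z); (5, 25, (2)%Z); (5, 26, (-1)%Z); (5, 31, (-1)%Z); (5, 32, (1)%Z); (5, 33, (2)%Z);
    (5, 34, (1)%Z); (5, 39, (-1)%Z); (5, 41, (-1)%Z); (5, 43, (1)%Z); (5, 44, (2)%Z); (5, 46, (-1)%Z);
    (6, 1, (1)%Z); (6, 4, (1)%Z); (6, 8, (-1)%Z); (6, 10, (-1)%Z); (6, 13, (-1)%Z); (6, 21, (1)%Z);
    (6, 26, (1)%Z); (6, 27, (-1)%Z); (6, 33, (-1)%Z); (6, 35, (-1)%Z); (6, 39, (1)%Z); (6, 41, (1)%Z);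
    (6, 42, (1)%Z); (6, 47, (-1)%Z); (7, 1, (-1)%Z); (7, 3, (-1)%Z); (7, 4, (2)%Z); (7, 9, (1)%Z);
    (7, 11, (-2)%Z); (7, 12, (1)%Z); (7, 14, (-1)%Z); (7, 19, (2)%Z); (7, 24, (1)%Z); (7, 26, (-1)%Z);
    (7, 28, (2)%Z); (7, 29, (-1)%Z); (7, 34, (1)%Z); (7, 35, (2)%Z); (7, 37, (-1)%Z); (7, 41, (-1)%Z);
    (7, 42, (1)%Z); (7, 43, (-2)%Z); (7, 44, (1)%Z); (7, 46, (-1)%Z); (8, 0, (1)%Z); (8, 3, (-1)%Z);
    (8, 6, (1)%Z); (8, 11, (1)%Z); (8, 16, (-1)%Z); (8, 18, (-1)%Z); (8, 25, (-1)%Z); (8, 29, (1)%Z);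
    (8, 34, (-1)%Z); (8, 36, (1)%Z); (8, 39, (-1)%Z); (8, 43, (-1)%Z); (8, 45, (1)%Z); (8, 46, (1)%Z);
    (9, 0, (1)%Z); (9, 1, (-2)%Z); (9, 4, (-1)%Z); (9, 5, (-2)%Z); (9, 7, (-1)%Z); (9, 10, (1)%Z);
    (9, 13, (1)%Z); (9, 20, (2)%Z); (9, 25, (2)%Z); (9, 27, (-1)%Z); (9, 29, (2)%Z); (9, 30, (-1)%Z);
    (9, 35, (-1)%Z); (9, 36, (1)%Z); (9, 38, (1)%Z); (9, 39, (1)%Z); (9, 41, (1)%Z); (9, 43, (-1)%Z);
    (9, 44, (-2)%Z); (9, 47, (-1)%Z); (10, 0, (-2)%Z); (10, 3, (-1)%Z); (10, 6, (1)%Z); (10, 9, (-1)%Z);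
    (10, 11, (-1)%Z); (10, 14, (-2)%Z); (10, 17, (-2)%Z); (10, 24, (2)%Z); (10, 25, (-1)%Z); (10, 28, (-1)%Z);
    (10, 29, (1)%Z); (10, 31, (1)%Z); (10, 32, (-1)%Z); (10, 37, (1)%Z); (10, 38, (2)%Z); (10, 41, (-2)%Z);
    (10, 43, (1)%Z); (10, 44, (1)%Z); (10, 45, (1)%Z); (10, 46, (1)%Z); (11, 1, (-1)%Z); (11, 4, (2)%Z);
    (11, 5, (-1)%Z); (11, 7, (2)%Z); (11, 8, (-1)%Z); (11, 10, (1)%Z); (11, 19, (2)%Z); (11, 24, (1)%Z);
    (11, 27, (-1)%Z); (11, 28, (2)%Z); (11, 30, (-1)%Z); (11, 31, (2)%Z); (11, 33, (-1)%Z); (11, 38, (1)%Z);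
    (11, 40, (-1)%Z); (11, 41, (1)%Z); (11, 42, (-1)%Z); (11, 43, (2)%Z); (11, 44, (-1)%Z); (11, 47, (-1)%Z);
    (12, 0, (1)%Z); (12, 2, (-1)%Z); (12, 7, (-1)%Z); (12, 13, (1)%Z); (12, 18, (-1)%Z); (12, 25, (-1)%Z);
    (12, 27, (-1)%Z); (12, 32, (1)%Z); (12, 33, (1)%Z); (12, 38, (-1)%Z); (12, 39, (1)%Z); (12, 43, (1)%Z);
    (12, 45, (-1)%Z); (12, 47, (1)%Z); (13, 3, (-1)%Z); (13, 6, (1)%Z); (13, 9, (-1)%Z); (13, 12, (-1)%Z);
    (13, 15, (-1)%Z); (13, 24, (-1)%Z); (13, 28, (1)%Z); (13, 31, (-1)%Z); (13, 34, (1)%Z); (13, 40, (1)%Z);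
    (13, 42, (-1)%Z); (13, 44, (1)%Z); (13, 45, (1)%Z); (13, 46, (1)%Z); (14, 0, (-2)%Z); (14, 2, (-1)%Z);
    (14, 5, (1)%Z); (14, 7, (1)%Z); (14, 10, (2)%Z); (14, 17, (-2)%Z); (14, 24, (2)%Z); (14, 25, (-1)%Z);
    (14, 27, (-1)%Z); (14, 28, (-1)%Z); (14, 33, (1)%Z); (14, 34, (2)%Z); (14, 35, (1)%Z); (14, 36, (-1)%Z);
    (14, 40, (1)%Z); (14, 41, (2)%Z); (14, 43, (-1)%Z); (14, 44, (-1)%Z); (14, 45, (-1)%Z); (14, 47, (1)%Z);
    (15, 0, (1)%Z); (15, 4, (1)%Z); (15, 13, (1)%Z); (15, 16, (1)%Z); (15, 26, (-1)%Z); (15, 29, (-1)%Z);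
    (15, 30, (1)%Z); (15, 32, (-1)%Z); (15, 33, (1)%Z); (15, 36, (1)%Z); (15, 41, (-1)%Z); (15, 43, (-1)%Z);
    (15, 46, (-1)%Z); (15, 47, (-1)%Z); (16, 2, (-1)%Z); (16, 5, (1)%Z); (16, 8, (1)%Z); (16, 15, (-1)%Z);
    (16, 24, (-1)%Z); (16, 27, (-1)%Z); (16, 28, (1)%Z); (16, 35, (-1)%Z); (16, 37, (1)%Z); (16, 38, (1)%Z);
    (16, 42, (1)%Z); (16, 44, (-1)%Z); (16, 45, (-1)%Z); (16, 47, (1)%Z); (17, 0, (-2)%Z); (17, 1, (-1)%Z);
    (17, 4, (-1)%Z); (17, 10, (2)%Z); (17, 14, (2)%Z); (17, 24, (2)%Z); (17, 26, (-1)%Z); (17, 29, (-1)%Z);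
    (17, 30, (1)%Z); (17, 31, (-1)%Z); (17, 33, (1)%Z); (17, 34, (-2)%Z); (17, 35, (1)%Z); (17, 38, (2)%Z);
    (17, 39, (-1)%Z); (17, 42, (1)%Z); (17, 43, (1)%Z); (17, 44, (1)%Z); (17, 46, (-1)%Z); (17, 47, (-1)%Z);
    (18, 1, (-1)%Z); (18, 8, (1)%Z); (18, 12, (1)%Z); (18, 24, (-1)%Z); (18, 26, (-1)%Z); (18, 30, (1)%Z);
    (18, 31, (1)%Z); (18, 35, (-1)%Z); (18, 37, (-1)%Z); (18, 40, (1)%Z); (18, 41, (1)%Z); (18, 44, (1)%Z);
    (18, 46, (-1)%Z); (18, 47, (-1)%Z); (19, 0, (-1)%Z); (19, 4, (-2)%Z); (19, 7, (-2)%Z); (19, 11, (-2)%Z);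
    (19, 25, (-1)%Z); (19, 28, (2)%Z); (19, 29, (1)%Z); (19, 31, (-2)%Z); (19, 32, (-1)%Z); (19, 33, (-1)%Z);
    (19, 34, (1)%Z); (19, 35, (2)%Z); (19, 36, (1)%Z); (19, 38, (-1)%Z); (19, 39, (-1)%Z); (19, 41, (1)%Z);
    (19, 44, (1)%Z); (19, 45, (1)%Z); (19, 46, (1)%Z); (19, 47, (1)%Z); (20, 1, (-2)%Z); (20, 5, (-2)%Z);
    (20, 9, (-2)%Z); (20, 24, (-1)%Z); (20, 25, (-2)%Z); (20, 28, (-1)%Z); (20, 29, (2)%Z); (20, 31, (1)%Z);
    (20, 33, (-2)%Z); (20, 34, (1)%Z); (20, 35, (-1)%Z); (20, 37, (1)%Z); (20, 38, (-1)%Z); (20, 40, (-1)%Z);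
    (20, 41, (1)%Z); (20, 42, (1)%Z); (20, 43, (1)%Z); (20, 45, (1)%Z); (20, 46, (1)%Z); (20, 47, (1)%Z);
    (21, 2, (-1)%Z); (21, 6, (-1)%Z); (21, 25, (-1)%Z); (21, 28, (-1)%Z); (21, 32, (1)%Z); (21, 34, (1)%Z);
    (21, 36, (-1)%Z); (21, 37, (1)%Z); (21, 38, (-1)%Z); (21, 40, (-1)%Z); (21, 43, (1)%Z); (21, 44, (1)%Z);
    (21, 46, (1)%Z); (21, 47, (1)%Z); (22, 3, (-1)%Z); (22, 26, (-1)%Z); (22, 29, (-1)%Z); (22, 31, (-1)%Z);
    (22, 32, (1)%Z); (22, 34, (1)%Z); (22, 37, (1)%Z); (22, 39, (-1)%Z); (22, 41, (-1)%Z); (22, 42, (-1)%Z);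
    (22, 43, (1)%Z); (22, 44, (1)%Z); (22, 45, (1)%Z); (22, 47, (1)%Z); (23, 27, (-1)%Z); (23, 30, (-1)%Z);
    (23, 33, (-1)%Z); (23, 35, (-1)%Z); (23, 36, (1)%Z); (23, 38, (1)%Z); (23, 39, (-1)%Z); (23, 40, (1)%Z);
    (23, 41, (-1)%Z); (23, 42, (-1)%Z); (23, 43, (1)%Z); (23, 44, (1)%Z); (23, 45, (1)%Z); (23, 46, (1)%Z);
    (24, 4, (-1)%Z); (24, 7, (-1)%Z); (24, 10, (-2)%Z); (24, 11, (-1)%Z); (24, 13, (1)%Z); (24, 14, (-2)%Z);
    (24, 16, (1)%Z); (24, 17, (-2)%Z); (24, 18, (1)%Z); (24, 20, (1)%Z); (24, 25, (1)%Z); (24, 29, (1)%Z);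
    (24, 32, (1)%Z); (24, 33, (1)%Z); (24, 34, (-2)%Z); (24, 36, (1)%Z); (24, 38, (-2)%Z); (24, 39, (1)%Z);
    (24, 41, (-2)%Z); (24, 43, (-1)%Z); (25, 4, (1)%Z); (25, 5, (-2)%Z); (25, 8, (1)%Z); (25, 9, (-2)%Z);
    (25, 10, (1)%Z); (25, 12, (1)%Z); (25, 14, (1)%Z); (25, 19, (1)%Z); (25, 20, (2)%Z); (25, 21, (1)%Z);
    (25, 24, (-1)%Z); (25, 26, (1)%Z); (25, 29, (-2)%Z); (25, 30, (1)%Z); (25, 31, (-1)%Z); (25, 33, (-2)%Z);
    (25, 35, (-1)%Z); (25, 41, (-1)%Z); (25, 42, (-1)%Z); (25, 44, (-2)%Z); (26, 5, (1)%Z); (26, 6, (-1)%Z);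
    (26, 7, (1)%Z); (26, 15, (1)%Z); (26, 17, (1)%Z); (26, 18, (1)%Z); (26, 22, (1)%Z); (26, 25, (-1)%Z);
    (26, 27, (1)%Z); (26, 28, (-1)%Z); (26, 36, (-1)%Z); (26, 38, (-1)%Z); (26, 40, (-1)%Z); (26, 45, (-1)%Z);
    (27, 6, (1)%Z); (27, 9, (1)%Z); (27, 11, (1)%Z); (27, 12, (1)%Z); (27, 14, (1)%Z); (27, 16, (1)%Z);
    (27, 23, (1)%Z); (27, 26, (-1)%Z); (27, 29, (-1)%Z); (27, 31, (-1)%Z); (27, 32, (-1)%Z); (27, 34, (-1)%Z);
    (27, 37, (-1)%Z); (27, 46, (-1)%Z); (28, 0, (-1)%Z); (28, 1, (1)%Z); (28, 7, (-2)%Z); (28, 10, (1)%Z);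
    (28, 11, (-2)%Z); (28, 13, (-1)%Z); (28, 14, (1)%Z); (28, 16, (-1)%Z); (28, 19, (-2)%Z); (28, 20, (1)%Z);
    (28, 21, (1)%Z); (28, 26, (1)%Z); (28, 29, (-1)%Z); (28, 30, (1)%Z); (28, 31, (2)%Z); (28, 33, (-1)%Z);
    (28, 35, (2)%Z); (28, 39, (1)%Z); (28, 41, (-1)%Z); (28, 43, (-2)%Z); (29, 1, (-2)%Z); (29, 2, (1)%Z);
    (29, 7, (1)%Z); (29, 8, (-1)%Z); (29, 9, (-2)%Z); (29, 10, (-1)%Z); (29, 15, (1)%Z); (29, 17, (1)%Z);
    (29, 19, (-1)%Z); (29, 20, (-2)%Z); (29, 22, (1)%Z); (29, 24, (-1)%Z); (29, 25, (2)%Z); (29, 27, (1)%Z);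
    (29, 28, (1)%Z); (29, 33, (-2)%Z); (29, 35, (-1)%Z); (29, 38, (1)%Z); (29, 40, (1)%Z); (29, 44, (-2)%Z);
    (30, 2, (-1)%Z); (30, 3, (1)%Z); (30, 9, (1)%Z); (30, 11, (1)%Z); (30, 15, (-1)%Z); (30, 17, (-1)%Z);
    (30, 18, (-1)%Z); (30, 23, (1)%Z); (30, 25, (-1)%Z); (30, 28, (-1)%Z); (30, 32, (1)%Z); (30, 34, (1)%Z);
    (30, 37, (1)%Z); (30, 45, (-1)%Z); (31, 0, (-1)%Z); (31, 2, (1)%Z); (31, 4, (-2)%Z); (31, 5, (1)%Z);
    (31, 10, (-1)%Z); (31, 11, (-2)%Z); (31, 13, (1)%Z); (31, 17, (1)%Z); (31, 18, (-1)%Z); (31, 19, (2)%Z);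
    (31, 20, (-1)%Z); (31, 22, (1)%Z); (31, 25, (1)%Z); (31, 27, (1)%Z); (31, 28, (-2)%Z); (31, 33, (-1)%Z);
    (31, 35, (2)%Z); (31, 36, (-1)%Z); (31, 38, (1)%Z); (31, 43, (-2)%Z); (32, 1, (1)%Z); (32, 5, (-1)%Z);
    (32, 10, (1)%Z); (32, 12, (-1)%Z); (32, 15, (1)%Z); (32, 19, (1)%Z); (32, 21, (-1)%Z); (32, 22, (-1)%Z);
    (32, 24, (-1)%Z); (32, 27, (1)%Z); (32, 30, (-1)%Z); (32, 35, (-1)%Z); (32, 40, (1)%Z); (32, 42, (1)%Z);
    (33, 1, (-2)%Z); (33, 3, (1)%Z); (33, 5, (-2)%Z); (33, 6, (1)%Z); (33, 11, (1)%Z); (33, 12, (-1)%Z);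
    (33, 14, (-1)%Z); (33, 15, (-1)%Z); (33, 17, (-1)%Z); (33, 19, (1)%Z); (33, 20, (2)%Z); (33, 23, (1)%Z);
    (33, 24, (-1)%Z); (33, 25, (2)%Z); (33, 28, (1)%Z); (33, 29, (2)%Z); (33, 31, (1)%Z); (33, 34, (-1)%Z);
    (33, 37, (-1)%Z); (33, 44, (-2)%Z); (34, 0, (-2)%Z); (34, 1, (1)%Z); (34, 4, (1)%Z); (34, 5, (-1)%Z);
    (34, 7, (-1)%Z); (34, 8, (1)%Z); (34, 13, (-1)%Z); (34, 14, (-2)%Z); (34, 17, (2)%Z); (34, 19, (-1)%Z);
    (34, 20, (-1)%Z); (34, 21, (-1)%Z); (34, 22, (-1)%Z); (34, 24, (2)%Z); (34, 27, (1)%Z); (34, 30, (-1)%Z);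
    (34, 33, (1)%Z); (34, 35, (1)%Z); (34, 38, (2)%Z); (34, 41, (2)%Z); (35, 0, (-1)%Z); (35, 3, (1)%Z);
    (35, 4, (-2)%Z); (35, 6, (1)%Z); (35, 7, (-2)%Z); (35, 9, (1)%Z); (35, 14, (-1)%Z); (35, 16, (1)%Z);
    (35, 17, (-1)%Z); (35, 18, (1)%Z); (35, 19, (-2)%Z); (35, 20, (1)%Z); (35, 23, (1)%Z); (35, 25, (1)%Z);
    (35, 28, (-2)%Z); (35, 29, (1)%Z); (35, 31, (-2)%Z); (35, 32, (1)%Z); (35, 34, (-1)%Z); (35, 43, (-2)%Z);
    (36, 1, (1)%Z); (36, 3, (1)%Z); (36, 8, (-1)%Z); (36, 9, (-1)%Z); (36, 14, (1)%Z); (36, 15, (-1)%Z);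
    (36, 19, (-1)%Z); (36, 21, (1)%Z); (36, 23, (-1)%Z); (36, 24, (-1)%Z); (36, 26, (1)%Z); (36, 31, (1)%Z);
    (36, 37, (-1)%Z); (36, 42, (1)%Z); (37, 0, (1)%Z); (37, 4, (-1)%Z); (37, 7, (1)%Z); (37, 10, (-1)%Z);
    (37, 16, (-1)%Z); (37, 18, (1)%Z); (37, 20, (-1)%Z); (37, 21, (-1)%Z); (37, 22, (-1)%Z); (37, 27, (1)%Z);
    (37, 30, (-1)%Z); (37, 33, (1)%Z); (37, 36, (1)%Z); (37, 39, (1)%Z); (38, 0, (-2)%Z); (38, 1, (1)%Z);
    (38, 3, (1)%Z); (38, 4, (1)%Z); (38, 9, (-1)%Z); (38, 10, (-2)%Z); (38, 11, (-1)%Z); (38, 12, (1)%Z);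
    (38, 16, (-1)%Z); (38, 17, (-2)%Z); (38, 19, (1)%Z); (38, 20, (1)%Z); (38, 21, (1)%Z); (38, 23, (-1)%Z);
    (38, 24, (2)%Z); (38, 26, (1)%Z); (38, 29, (-1)%Z); (38, 31, (-1)%Z); (38, 34, (-2)%Z); (38, 41, (2)%Z);
    (39, 2, (1)%Z); (39, 5, (1)%Z); (39, 6, (-1)%Z); (39, 8, (1)%Z); (39, 9, (-1)%Z); (39, 12, (-1)%Z);
    (39, 17, (1)%Z); (39, 19, (1)%Z); (39, 22, (1)%Z); (39, 23, (1)%Z); (39, 24, (-1)%Z); (39, 28, (-1)%Z);
    (39, 37, (-1)%Z); (39, 40, (-1)%Z); (40, 0, (1)%Z); (40, 3, (1)%Z); (40, 4, (-1)%Z); (40, 11, (1)%Z);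
    (40, 13, (-1)%Z); (40, 14, (-1)%Z); (40, 18, (-1)%Z); (40, 20, (1)%Z); (40, 21, (1)%Z); (40, 23, (-1)%Z);
    (40, 26, (1)%Z); (40, 29, (-1)%Z); (40, 32, (-1)%Z); (40, 39, (1)%Z); (41, 0, (-2)%Z); (41, 2, (1)%Z);
    (41, 5, (1)%Z); (41, 6, (-1)%Z); (41, 7, (1)%Z); (41, 9, (-1)%Z); (41, 10, (2)%Z); (41, 11, (-1)%Z);
    (41, 14, (-2)%Z); (41, 15, (1)%Z); (41, 18, (-1)%Z); (41, 19, (-1)%Z); (41, 20, (-1)%Z); (41, 22, (1)%Z);
    (41, 23, (1)%Z); (41, 24, (2)%Z); (41, 25, (1)%Z); (41, 28, (1)%Z); (41, 34, (-2)%Z); (41, 38, (-2)%Z);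
    (42, 0, (1)%Z); (42, 2, (1)%Z); (42, 6, (-1)%Z); (42, 7, (-1)%Z); (42, 11, (1)%Z); (42, 13, (1)%Z);
    (42, 16, (-1)%Z); (42, 17, (-1)%Z); (42, 20, (-1)%Z); (42, 22, (1)%Z); (42, 23, (1)%Z); (42, 25, (1)%Z);
    (42, 32, (-1)%Z); (42, 36, (-1)%Z); (43, 1, (1)%Z); (43, 4, (-2)%Z); (43, 5, (-1)%Z); (43, 7, (2)%Z);
    (43, 8, (1)%Z); (43, 9, (1)%Z); (43, 10, (-1)%Z); (43, 11, (-2)%Z); (43, 12, (-1)%Z); (43, 14, (1)%Z);
    (43, 15, (1)%Z); (43, 17, (-1)%Z); (43, 20, (-1)%Z); (43, 21, (-1)%Z); (43, 22, (-1)%Z); (43, 23, (-1)%Z);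
    (43, 24, (1)%Z); (43, 28, (2)%Z); (43, 31, (2)%Z); (43, 35, (2)%Z); (44, 0, (1)%Z); (44, 1, (2)%Z);
    (44, 4, (1)%Z); (44, 5, (-2)%Z); (44, 7, (-1)%Z); (44, 9, (2)%Z); (44, 10, (-1)%Z); (44, 11, (1)%Z);
    (44, 13, (-1)%Z); (44, 14, (1)%Z); (44, 16, (1)%Z); (44, 17, (-1)%Z); (44, 18, (-1)%Z); (44, 19, (-1)%Z);
    (44, 21, (-1)%Z); (44, 22, (-1)%Z); (44, 23, (-1)%Z); (44, 25, (2)%Z); (44, 29, (2)%Z); (44, 33, (2)%Z);
    (45, 1, (1)%Z); (45, 4, (1)%Z); (45, 8, (-1)%Z); (45, 10, (-1)%Z); (45, 12, (1)%Z); (45, 13, (-1)%Z);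
    (45, 14, (1)%Z); (45, 16, (1)%Z); (45, 19, (-1)%Z); (45, 20, (-1)%Z); (45, 22, (-1)%Z); (45, 23, (-1)%Z);
    (45, 26, (1)%Z); (45, 30, (1)%Z); (46, 2, (1)%Z); (46, 5, (1)%Z); (46, 7, (1)%Z); (46, 8, (-1)%Z);
    (46, 10, (-1)%Z); (46, 13, (-1)%Z); (46, 15, (1)%Z); (46, 17, (1)%Z); (46, 18, (1)%Z); (46, 19, (-1)%Z);
    (46, 20, (-1)%Z); (46, 21, (-1)%Z); (46, 23, (-1)%Z); (46, 27, (1)%Z); (47, 3, (1)%Z); (47, 6, (1)%Z);
    (47, 9, (1)%Z); (47, 11, (1)%Z); (47, 12, (-1)%Z); (47, 14, (-1)%Z); (47, 15, (1)%Z); (47, 16, (-1)%Z);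
    (47, 17, (1)%Z); (47, 18, (1)%Z); (47, 19, (-1)%Z); (47, 20, (-1)%Z); (47, 21, (-1)%Z); (47, 22, (-1)%Z)].

Definition F4 : rootdata := {|
  rk := 4; nroots := 48;
  bform := F4_form; rts := F4_roots; ntab := F4_Ntab;
  w0word := [:: 0; 1; 2; 3; 0; 1; 2; 3; 0; 1; 2; 3; 0; 1; 2; 3; 0; 1; 2; 3; 0; 1; 2; 3] |}.

(** ** Data for type G2 (Bourbaki labelling; simple root i of the paper is index i-1 here). *)

Definition G2_form : seq (seq int) := [:: [:: (2); (-3)]; [:: (-3); (6)]]%Z.

(** The roots, as coefficient vectors w.r.t. the simple roots:
    positive roots by increasing height, then their negatives in the same order. *)
Definition G2_roots : seq (seq int) := [::
    [:: (0); (1)];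
    [:: (1); (0)];
    [:: (1); (1)];
    [:: (2); (1)];
    [:: (3); (1)];
    [:: (3); (2)];
    [:: (0); (-1)];
    [:: (-1); (0)];
    [:: (-1); (-1)];
    [:: (-2); (-1)];
    [:: (-3); (-1)];
    [:: (-3); (-2)]]%Z.

(** Structure constants of a Chevalley basis: (a, b, N) means [e_a, e_b] = N e_(a+b). *)
Definition G2_Ntab : seq (nat * nat * int) := [::
    (0, 1, (-1)%Z); (0, 4, (1)%Z); (0, 8, (1)%Z); (0, 11, (-1)%Z); (1, 0, (1)%Z); (1, 2, (2)%Z);
    (1, 3, (3)%Z); (1, 8, (-3)%Z); (1, 9, (-2)%Z); (1, 10, (-1)%Z); (2, 1, (-2)%Z); (2, 3, (-3)%Z);
    (2, 6, (1)%Z); (2, 7, (-3)%Z); (2, 9, (2)%Z); (2, 11, (1)%Z); (3, 1, (-3)%Z); (3, 2, (3)%Z);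
    (3, 7, (-2)%Z); (3, 8, (2)%Z); (3, 10, (1)%Z); (3, 11, (-1)%Z); (4, 0, (-1)%Z); (4, 7, (-1)%Z);
    (4, 9, (1)%Z); (4, 11, (1)%Z); (5, 6, (-1)%Z); (5, 8, (1)%Z); (5, 9, (-1)%Z); (5, 10, (1)%Z);
    (6, 2, (-1)%Z); (6, 5, (1)%Z); (6, 7, (1)%Z); (6, 10, (-1)%Z); (7, 2, (3)%Z); (7, 3, (2)%Z);
    (7, 4, (1)%Z); (7, 6, (-1)%Z); (7, 8, (-2)%Z); (7, 9, (-3)%Z); (8, 0, (-1)%Z); (8, 1, (3)%Z);
    (8, 3, (-2)%Z); (8, 5, (-1)%Z); (8, 7, (2)%Z); (8, 9, (3)%Z); (9, 1, (2)%Z); (9, 2, (-2)%Z);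
    (9, 4, (-1)%Z); (9, 5, (1)%Z); (9, 7, (3)%Z); (9, 8, (-3)%Z); (10, 1, (1)%Z); (10, 3, (-1)%Z);
    (10, 5, (-1)%Z); (10, 6, (1)%Z); (11, 0, (1)%Z); (11, 2, (-1)%Z); (11, 3, (1)%Z); (11, 4, (-1)%Z)].

Definition G2 : rootdata := {|
  rk := 2; nroots := 12;
  bform := G2_form; rts := G2_roots; ntab := G2_Ntab;
  w0word := [:: 0; 1; 0; 1; 0; 1] |}.

(* Main.v *)
Require Import Defs.
From mathcomp Require Import all_boot all_order all_algebra.
Set Implicit Arguments.
Unset Strict Implicit.
Unset Printing Implicit Defensive.
Import GRing.Theory Num.Theory.
Local Open Scope ring_scope.

(** Every nontrivial short root element is conjugate to theta = x_a(1), where -a is the highest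
short root, because the elements w_j permute the root subgroups and the torus rescales them.

If theta maps a vertex of type i to an opposite one, then some conjugate of theta lies in
P n0 P, P the maximal parabolic subgroup of type i. Let V be the span of the root vectors whose
alpha_i-coefficient is maximal, and V- that of their negatives. The block V -> V- of an element
of P n0 P is invertible. On the other hand, let K be the invariant form normalised by
K(e_b, e_-b) = 1 for long b. For the types 1, 2, 3 of F4 and 2 of G2, V is spanned by long root
vectors, and K(v, theta w) = - K(v, e_a) K(w, e_a) for v, w in gV: twice the left hand side is
K(e_a, [v, [w, e_a]]), and ad v ad w = - (v K(w, .) + w K(v, .)). The factor 2 is harmless
because the group elements lift to the torsion-free ring Z[X_1, ..., X_m]. Hence the block has
rank at most one, which excludes the types 2 and 3 of F4, where dim V >= 2. Moreover K(., e_a)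
is 2 (F4) or 3 (G2) times a coordinate, so that in characteristic 2 or 3 the block vanishes.

The remaining types are realised by explicit words. For the type of the highest short root,
theta itself lies in P n0 P. For that of the highest long root r, x_a(1) with a short is
conjugate by some x_b(s), b short and a + b = -r, to x_{-r}(c s) x_a(1) with c = 2 or 3 up to
sign, and this lies in P n0 P when c s = 1. All identities between integral matrices
are verified by computation with sparse matrices. *)

(** * Sparse integer matrices *)

Definition svec := seq (nat * int).
(* A sparse matrix is the sequence of its columns. *)
Definition smat := seq svec.

(** Entries with the same index add up, so lists need not be normalised. Here and below the concrete
    integer operations replace the generic ring operations, so that [vm_compute] evaluates them
    directly. *)
Fixpoint scoef (v : svec) (r : nat) : int :=
  if v is p :: v' then
    if eqn p.1 r then intZmod.addz p.2 (scoef v' r) else scoef v' r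
  else 0.

Fixpoint sins (k : nat) (c : int) (v : svec) : svec :=
  match v with
  | [::] => [:: (k, c)]
  | p :: v' =>
      if eqn k p.1 then
        let d := intZmod.addz c p.2 in if d is Posz 0 then v' else (k, d) :: v'
      else if (k < p.1)%N then (k, c) :: v else p :: sins k c v'
  end.
(** The result is sorted by index, without repetitions or zeros, so that vectors with equal
    coefficients are recognised by boolean equality of lists. *)
Definition nform (v : svec) : svec :=
  foldr (fun p w => if p.2 is Posz 0 then w else sins p.1 p.2 w) [::] v.
Definition sscale (c : int) (v : svec) : svec := [seq (p.1, intRing.mulz c p.2) | p <- v].
Definition scol (M : smat) j : svec := nth [::] M j.
Definition sapp (M : smat) (v : svec) : svec :=
  flatten [seq sscale p.2 (scol M p.1) | p <- v].
Definition smul (A B : smat) : smat := [seq nform (sapp A v) | v <- B].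
Definition sid n : smat := mkseq (fun i => [:: (i, 1)]) n.
Definition smscale c (M : smat) : smat := [seq sscale c v | v <- M].
Definition smdiv (d : int) (M : smat) : smat :=
  [seq [seq (p.1, (p.2 %/ d)%Z) | p <- v] | v <- M].

Lemma scoef_cons p v r : scoef (p :: v) r = (p.1 == r)%:R * p.2 + scoef v r.
Proof. by rewrite /= eqnE; case: eqP => _; rewrite ?mul1r // mul0r add0r. Qed.

Arguments scoef : simpl never.

Lemma scoef1 k c r : scoef [:: (k, c)] r = (k == r)%:R * c.
Proof. by rewrite scoef_cons addr0. Qed.

Lemma scoef_cat u v r : scoef (u ++ v) r = scoef u r + scoef v r.
Proof. by elim: u => [|p u IH]; rewrite ?add0r // cat_cons !scoef_cons IH addrA. Qed.

Lemma scoef_scale c v r : scoef (sscale c v) r = c * scoef v r.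
Proof.
elim: v => [|p v IH]; first by rewrite mulr0.
by rewrite /sscale map_cons !scoef_cons -/(sscale c v) IH mulrDr mulrCA.
Qed.

Lemma scoef_sins k c v r : scoef (sins k c v) r = (k == r)%:R * c + scoef v r.
Proof.
elim: v => [|p v IH] /=; first by rewrite scoef_cons.
rewrite eqnE; case: eqP => [->|_]; last first.
  by case: ltnP => _; rewrite !scoef_cons // IH addrCA.
have -> : (scoef (p :: v) r) = (p.1 == r)%:R * p.2 + scoef v r by exact: scoef_cons.
have : intZmod.addz c p.2 = c + p.2 by [].
by rewrite addrA -mulrDr; case: (intZmod.addz c p.2) => [[|m]|m] <-;
   rewrite ?scoef_cons ?mulr0 ?add0r.
Qed.

Lemma scoef_nform v r : scoef (nform v) r = scoef v r.
Proof.
elim: v => [|[k c] v IH] //.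
rewrite scoef_cons /= -/(nform v).
by case: c => [[|m]|m]; rewrite ?scoef_sins IH //= mulr0 add0r.
Qed.

Lemma scoef_nform_eq u v r : nform u = nform v -> scoef u r = scoef v r.
Proof. by move=> E; rewrite -scoef_nform E scoef_nform. Qed.

(** Indices from [n] on may occur in [v]; the vanishing of [f] there discards them. *)
Lemma sum_scoef n (v : svec) (f : nat -> int) : (forall k, (n <= k)%N -> f k = 0) ->
  \sum_(p <- v) p.2 * f p.1 = \sum_(k < n) f k * scoef v k.
Proof.
move=> f0; elim: v => [|p v IH].
  by rewrite big_nil big1 // => k _; rewrite mulr0.
rewrite big_cons IH; under [in RHS]eq_bigr => k _ do rewrite scoef_cons mulrDr.
rewrite big_split /=; congr (_ + _).
have [ltpn|lenp] := ltnP p.1 n.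
  rewrite (bigD1 (Ordinal ltpn)) //= eqxx mul1r mulrC big1 ?addr0 // => k.
  by rewrite -val_eqE /= eq_sym => /negPf->; rewrite mul0r mulr0.
rewrite f0 // mulr0 big1 // => k _; case: eqP => [E|]; last by rewrite mul0r mulr0.
by move: (ltn_ord k); rewrite -E ltnNge lenp.
Qed.

Lemma scoef_flatten (vs : seq svec) r : scoef (flatten vs) r = \sum_(v <- vs) scoef v r.
Proof. by elim: vs => [|v vs IH]; rewrite ?big_nil // big_cons /= scoef_cat IH. Qed.

Lemma scol_out n (M : smat) k : (size M <= n)%N -> (n <= k)%N -> scol M k = [::].
Proof. by move=> sM le; rewrite /scol nth_default // (leq_trans sM). Qed.

Lemma scoef_sapp_le n (M : smat) v r : (size M <= n)%N ->
  scoef (sapp M v) r = \sum_(k < n) scoef (scol M k) r * scoef v k.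
Proof.
move=> sM; rewrite /sapp scoef_flatten big_map.
rewrite -(@sum_scoef n v (fun k => scoef (scol M k) r)) => [|k le].
  by apply: eq_bigr => p _; rewrite scoef_scale.
by rewrite (scol_out sM).
Qed.

Lemma scoef_sapp n (M : smat) v r : size M = n ->
  scoef (sapp M v) r = \sum_(k < n) scoef (scol M k) r * scoef v k.
Proof. by move=> <-; apply: scoef_sapp_le. Qed.

Definition smx n (M : smat) : 'M[int]_n := \matrix_(r, c) scoef (scol M c) r.

Lemma scol_map (f : svec -> svec) M j : f [::] = [::] -> scol [seq f v | v <- M] j = f (scol M j).
Proof.
move=> f0; rewrite /scol; have [lt|le] := ltnP j (size M); first exact: nth_map.
by rewrite !nth_default ?size_map.
Qed.

Lemma smx_mul n (A B : smat) : size A = n -> smx n (smul A B) = smx n A *m smx n B.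
Proof.
move=> sA; apply/matrixP => r c; rewrite !mxE scol_map // scoef_nform (scoef_sapp _ _ sA).
by apply: eq_bigr => k _; rewrite !mxE.
Qed.

Lemma size_smul A B : size (smul A B) = size B.
Proof. exact: size_map. Qed.

Lemma smx_id n : smx n (sid n) = 1%:M.
Proof.
apply/matrixP => r c; rewrite !mxE /scol nth_mkseq // scoef_cons mulr1 addr0.
by rewrite [in RHS]eq_sym pmulrn; case: eqP.
Qed.

Lemma smx_scale n c (M : smat) : smx n (smscale c M) = c *: smx n M.
Proof. by apply/matrixP => r j; rewrite !mxE scol_map // scoef_scale. Qed.

Lemma smx_nseq n m : smx n (nseq m [::]) = 0.
Proof. by apply/matrixP => r j; rewrite !mxE /scol nth_nseq if_same. Qed.

(** * Bracket tables *)

Section Tables.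
Variable D : rootdata.
Let n := ldim D.
Let nr := nroots D.

(** A counterpart of [bil] that evaluates under [vm_compute], where big operators do not; likewise
    [pairingc] and [corootcc]. *)
Definition bilc (u v : seq int) : int :=
  foldr intZmod.addz 0 [seq foldr intZmod.addz 0
    [seq intRing.mulz (intRing.mulz (nth 0 u i) (nth 0 (nth [::] (bform D) i) j)) (nth 0 v j)
      | j <- iota 0 (rk D)] | i <- iota 0 (rk D)].
Definition pairingc b i : int :=
  ((2 * bilc (rootv D b) (unitv D i)) %/ bilc (unitv D i) (unitv D i))%Z.
Definition corootcc a i : int :=
  ((rcoef D a i * bilc (unitv D i) (unitv D i)) %/ bilc (rootv D a) (rootv D a))%Z.

(** [tb] is the table of structure constants already restricted to first index [a]. *)
Definition adcol (tb : seq (nat * nat * int)) (a j : nat) : svec :=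
  if (j < nr)%N then
    let v := vadd D (rootv D a) (rootv D j) in
    if v == nseq (rk D) 0 then
      [seq ((nr + i)%N, corootcc a i) | i <- iota 0 (rk D)]
    else let k := rindex D v in
      if (k < nr)%N then
        [:: (k, head 0 [seq x.2 | x <- tb & x.1.2 == j])]
      else [::]
  else [:: (a, - pairingc a (j - nr))].

Definition root_ads : seq smat :=
  [seq let tb := [seq x <- ntab D | x.1.1 == a] in
     [seq nform (adcol tb a j) | j <- iota 0 n] | a <- iota 0 nr].
(* The rows of the Cartan elements h_i are filled in by antisymmetry. *)
Definition mkads (T : seq smat) : seq smat :=
  T ++ [seq [seq sscale (-1) (scol (nth [::] T j) (nr + i)) | j <- iota 0 nr]
            ++ nseq (rk D) [::] | i <- iota 0 (rk D)].
Definition ads : seq smat := mkads root_ads.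

Lemma foldr_addz (f : nat -> int) m :
  foldr intZmod.addz 0 [seq f i | i <- iota 0 m] = \sum_(i < m) f i.
Proof.
rewrite -(big_mkord xpredT f) /index_iota subn0.
by elim: (iota 0 m) => [|i s IH]; rewrite ?big_nil // big_cons -IH.
Qed.

Lemma bilE u v : bil D u v = bilc u v.
Proof.
rewrite /bilc foldr_addz; apply: eq_bigr => i _; rewrite (foldr_addz (fun j => nth 0 u i * nth 0 (nth [::] (bform D) i) j * nth 0 v j)).
by [].
Qed.

Lemma pairingE b i : pairing D b i = pairingc b i.
Proof. by rewrite /pairing /snorm !bilE. Qed.
Lemma corootE b i : corootc D b i = corootcc b i.
Proof. by rewrite /corootc /snorm /rnorm !bilE. Qed.

Lemma scoef_shift m (f : nat -> int) k :
  scoef [seq ((nr + i)%N, f i) | i <- iota 0 m] k =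
  if (nr <= k < nr + m)%N then f (k - nr)%N else 0.
Proof.
elim: m => [|m IH].
  by rewrite addn0; case: leqP.
rewrite -addn1 iotaD map_cat scoef_cat IH scoef_cons addr0 /= add0n addnA addn1 ltnS [(k <= _)%N]leq_eqVlt.
case: (eqVneq (nr + m)%N k) => [<-|ne].
  by rewrite ltnn leq_addr addKn mul1r andbF add0r.
by rewrite mul0r addr0.
Qed.

Lemma adZ_smx a : (a < nr)%N -> adZ D a = smx n (nth [::] ads a).
Proof.
move=> lta; apply/matrixP => k j; rewrite !mxE nth_cat size_map size_iota lta.
rewrite (nth_map 0%N) ?size_iota // nth_iota // add0n /scol.
rewrite (nth_map 0%N) ?size_iota // nth_iota // add0n scoef_nform /adcol.
case: ltnP => // [ltj|lej]; last first.
  rewrite scoef_cons addr0 /= pairingE eq_sym.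
  by case: eqP; rewrite ?mul1r ?mul0r.
case: ifP => _.
  rewrite scoef_shift corootE ltn_ord andbT //.
case: (ltnP (rindex D _) nr) => lek.
  rewrite scoef_cons addr0 /= /Nc eq_sym.
  case: eqP => [E|_]; last by rewrite mul0r andbF.
  by rewrite -E lek mul1r; rewrite -filter_predI; congr (head 0 (map _ _)); apply: eq_filter => x; rewrite /= andbC.
by case: eqP => [->|]; rewrite ?andbF // ltnNge lek.
Qed.
End Tables.

(** * Divided powers and the Jacobi identity *)

Section Checks.
Variables (D : rootdata) (T : seq smat).
Let n := ldim D.
Let nr := nroots D.

Definition dpow (M : smat) : seq smat :=
  let M2 := smul M M in
  [:: sid n; M; smdiv 2 M2; smdiv 6 (smul M M2)].
(** Multiplying back shows that the floor divisions in [dpow] are exact. The fourth power vanishes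
    because root strings in F4 and G2 have at most four members. *)
Definition dpow_ok (M : smat) : bool :=
  let M2 := smul M M in let M3 := smul M M2 in
  [&& smscale 2 (smdiv 2 M2) == M2, smscale 6 (smdiv 6 M3) == M3
    & smul M M3 == nseq n [::]].
Definition anti_ok : bool :=
  all (fun k => all (fun j =>
    scol (nth [::] T k) j == sscale (-1) (scol (nth [::] T j) k)) (iota 0 n)) (iota 0 n).
(** On basis vectors, [e_a, [x_k, x_c]] = [[e_a, x_k], x_c] + [x_k, [e_a, x_c]]: ad e_a is a
    derivation. *)
Definition jacobi_ok : bool :=
  all (fun a => let Ta := nth [::] T a in
    all (fun k => let Tk := nth [::] T k in
      all (fun c => nform (sapp Ta (scol Tk c)) ==
        nform (flatten [seq sscale q.2 (scol (nth [::] T q.1) c) | q <- scol Ta k]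
               ++ sapp Tk (scol Ta c)))
    (iota 0 n)) (iota 0 n)) (iota 0 nr).
Definition tables_ok : bool :=
  [&& (4 <= n)%N, size T == n, all (fun M => size M == n) T,
      all (fun a => dpow_ok (nth [::] T a)) (iota 0 nr), anti_ok & jacobi_ok].
End Checks.

Lemma allnP (m : nat) (P : pred nat) :
  reflect (forall k, (k < m)%N -> P k) (all P (iota 0 m)).
Proof.
apply: (iffP allP) => H k; first by move=> lt; apply: H; rewrite mem_iota.
by rewrite mem_iota; apply: H.
Qed.

(** Allows division by the integers k + 1 in inductions on divided powers, and by the 2 in the rank
    one identity. *)
Definition torsion_free (R : nmodType) : Prop := forall (m : nat) (z : R), z *+ m.+1 = 0 -> z = 0.

Lemma int_tf : torsion_free int.
Proof. by move=> m z /eqP; rewrite mulrn_eq0 => /eqP. Qed.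

Lemma mx_torsion (R : nzRingType) (tf : torsion_free R) p q m (M N : 'M[R]_(p, q)) :
  M *+ m.+1 = N *+ m.+1 -> M = N.
Proof.
move/matrixP => H; apply/matrixP => i j; apply/subr0_eq/(tf m).
by rewrite mulrnBl -!mulmxnE H subrr.
Qed.

Lemma mulMnl (R : nzRingType) p q s (A : 'M[R]_(p, q)) (B : 'M[R]_(q, s)) m :
  (A *+ m) *m B = (A *m B) *+ m.
Proof. exact: (raddfMn (mulmxr B)). Qed.

Lemma mulMnr (R : nzRingType) p q s (A : 'M[R]_(p, q)) (B : 'M[R]_(q, s)) m :
  A *m (B *+ m) = (A *m B) *+ m.
Proof. exact: (raddfMn (mulmx A)). Qed.

(** Terms outside the square i, j < m vanish, so the triangle of degrees below 2m has the same sum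
    as the square. *)
Lemma convolution (V : zmodType) m (f : nat -> nat -> V) :
  (forall i j, (m <= i)%N || (m <= j)%N -> f i j = 0) ->
  \sum_(i < m) \sum_(j < m) f i j =
  \sum_(k < m + m) \sum_(i < k.+1) f i (k - i)%N.
Proof.
move=> f0; under [RHS]eq_bigr => k _.
  rewrite (big_ord_widen (m + m) (fun i => f i (k - i)%N)); last exact: ltn_ord.
  over.
rewrite [RHS](exchange_big_dep xpredT) //= [RHS]big_split_ord /=.
set z := (X in _ = _ + X); have -> : z = 0.
  by apply: big1 => i _; apply: big1 => k _; apply/f0/orP; left; exact: leq_addr.
rewrite addr0; apply: eq_bigr => i _.
rewrite -(big_mkord xpredT (f i)).
rewrite -(big_mkord (fun k => i < k.+1)%N (fun k => f i (k - i)%N)).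
have lei : (i <= m + m)%N by rewrite (leq_trans (ltnW (ltn_ord i))) ?leq_addr.
rewrite [RHS](big_cat_nat (n := i)) //=.
rewrite [X in _ = X + _]big_nat_cond [X in _ = X + _]big1 ?add0r => [|k]; last first.
  by rewrite ltnS => /andP[/andP[_ lt]]; rewrite leqNgt lt.
rewrite (big_addn 0 (m + m) i) -addnBA; last exact: ltnW.
rewrite [RHS](big_cat_nat (n := m)) ?leq_addr //= [X in _ = _ + X]big_nat_cond.
rewrite [X in _ = _ + X]big1 ?addr0 => [|k /andP[/andP[lek _] _]]; last first.
  by rewrite addnK f0 // lek orbT.
by apply: congr_big_nat => // k lt; rewrite ?addnK // ltnS leq_addl.
Qed.

Section Lie.
Variable D : rootdata.
Local Notation n := (ldim D).
Local Notation nr := (nroots D).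
Hypothesis ok : tables_ok D (ads D).

Definition adk (k : nat) : 'M[int]_n := smx n (nth [::] (ads D) k).
Local Notation E := (adpowZ D).

Lemma ldim_ge4 : (4 <= n)%N. Proof. by case/and5P: ok. Qed.

Lemma size_ads k : (k < n)%N -> size (nth [::] (ads D) k) = n.
Proof.
case/and3P: ok => _ /eqP sT /andP[/all_nthP H _] lt.
by apply/eqP/H; rewrite sT.
Qed.

Lemma ads_out k : (n <= k)%N -> nth [::] (ads D) k = [::].
Proof. by case/and3P: ok => _ /eqP sT _ le; rewrite nth_default ?sT. Qed.

Lemma ltn_ldim a : (a < nr)%N -> (a < n)%N.
Proof. by move=> lt; rewrite (leq_trans lt) ?leq_addr. Qed.

Lemma adk_anti (i j k : 'I_n) : adk k i j = - adk j i k.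
Proof.
case/and5P: ok => _ _ _ _ /andP[/allnP H _].
by move/allnP/(_ _ (ltn_ord j))/eqP: (H _ (ltn_ord k)) => E; rewrite !mxE E scoef_scale mulN1r.
Qed.

Lemma adk_jacobi a (k : 'I_n) : (a < nr)%N ->
  adk a *m adk k = \sum_(l < n) adk a l k *: adk l + adk k *m adk a.
Proof.
move=> lta; case/and5P: ok => _ _ _ _ /andP[_ /allnP /(_ _ lta) /allnP /(_ _ (ltn_ord k)) H].
apply/matrixP => r c; move/allnP: H => /(_ _ (ltn_ord c))/eqP/scoef_nform_eq => /(_ r).
rewrite scoef_cat (scoef_sapp _ _ (size_ads (ltn_ldim lta))) (scoef_sapp _ _ (size_ads (ltn_ord k))).
rewrite scoef_flatten big_map.
under [in RHS]eq_bigr => q _ do rewrite scoef_scale.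
rewrite (@sum_scoef n _ (fun l => scoef (scol (nth [::] (ads D) l) c) r)) => [|l le]; last first.
  by rewrite ads_out // /scol nth_nil.
move=> H; rewrite !mxE summxE; under [LHS]eq_bigr => l _ do rewrite !mxE.
rewrite H; congr (_ + _); last by apply: eq_bigr => l _; rewrite !mxE.
by apply: eq_bigr => l _; rewrite !mxE mulrC.
Qed.

Lemma iter_mulmxD (A : 'M[int]_n) i j :
  iter i (mulmx A) 1%:M *m iter j (mulmx A) 1%:M = iter (i + j) (mulmx A) 1%:M.
Proof. by elim: i => [|i IH]; rewrite ?mul1mx //= -mulmxA IH. Qed.

Lemma adpowZ_div a k (X : 'M[int]_n) :
  iter k (mulmx (adZ D a)) 1%:M = X *+ k`! -> E a k = X.
Proof.
move=> H; apply/matrixP => i j; rewrite mxE H mulmxnE -mulr_natl natz mulKz //.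
by rewrite eqz_nat -lt0n fact_gt0.
Qed.

Lemma adpowZ_dpow a k : (a < nr)%N ->
  E a k = smx n (nth [::] (dpow D (nth [::] (ads D) a)) k) /\
  iter k (mulmx (adZ D a)) 1%:M = E a k *+ k`!.
Proof.
move=> lta; set M := nth [::] (ads D) a.
have sM : size M = n by apply/size_ads/ltn_ldim.
have okM : dpow_ok D M by case/and5P: ok => _ _ _ /allnP/(_ a lta).
have adE : adZ D a = smx n M by apply: adZ_smx.
suff H : iter k (mulmx (adZ D a)) 1%:M = smx n (nth [::] (dpow D M) k) *+ k`!.
  by rewrite (adpowZ_div H).
case/and3P: okM => /eqP E2 /eqP E3 /eqP E4.
rewrite -[_ *+ k`!]scaler_nat natz.
case: k => [|[|[|[|k]]]].
- by rewrite scale1r smx_id.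
- by rewrite scale1r /= mulmx1.
- by rewrite -smx_scale /= E2 smx_mul // mulmx1 adE.
- by rewrite -smx_scale /= E3 !smx_mul // mulmx1 adE.
(* The default entry is the empty list, which represents the zero matrix, in agreement with
   ad(e_a)^4 = 0. *)
have -> : nth [::] (dpow D M) k.+4 = [::] by rewrite nth_default.
have -> : smx n [::] = 0 by apply/matrixP => i j; rewrite !mxE /scol nth_nil.
rewrite scaler0 -addn4 -iter_mulmxD /= mulmx1 adE -!smx_mul // E4.
by rewrite smx_nseq mulmx0.
Qed.

Lemma adpowZ_fact a k : (a < nr)%N -> iter k (mulmx (adZ D a)) 1%:M = E a k *+ k`!.
Proof. by case/(@adpowZ_dpow a k). Qed.

Lemma adpowZ_ge4 a k : (a < nr)%N -> (4 <= k)%N -> E a k = 0.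
Proof.
case/(@adpowZ_dpow a k) => -> _ le; rewrite nth_default //.
by apply/matrixP => i j; rewrite !mxE /scol nth_nil.
Qed.

Lemma adpowZ0 a : E a 0 = 1%:M.
Proof. by apply: adpowZ_div; rewrite mulr1n. Qed.

Lemma adpowZ1 a : (a < nr)%N -> E a 1 = adk a.
Proof. by move=> lta; apply: adpowZ_div; rewrite /= mulmx1 mulr1n adZ_smx. Qed.

(** Writing ad(e_a)^(i+j) in two ways gives i! j! times the claim, and integers are torsion-free. *)
Lemma adpowZ_mul a i j : (a < nr)%N -> E a i *m E a j = E a (i + j) *+ 'C(i + j, i).
Proof.
move=> lta; have := iter_mulmxD (adZ D a) i j; rewrite !adpowZ_fact //.
rewrite mulMnl mulMnr -mulrnA [(j`! * i`!)%N]mulnC.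
rewrite -(@bin_fact (i + j) i) ?leq_addr // addKn [in RHS]mulrnA.
have : (0 < i`! * j`!)%N by rewrite muln_gt0 !fact_gt0.
by case: (i`! * j`!)%N => // m _ /(mx_torsion int_tf).
Qed.
End Lie.

(** * Root elements over a commutative ring *)

Section ScalarExtension.
Variable R : comNzRingType.

Definition toR p q (M : 'M[int]_(p, q)) : 'M[R]_(p, q) := map_mx (fun z : int => z%:~R) M.

Lemma toRM p q s (A : 'M[int]_(p, q)) (B : 'M[int]_(q, s)) : toR (A *m B) = toR A *m toR B.
Proof. exact: (map_mxM (intr : {rmorphism int -> R})). Qed.

Lemma toR1 p : toR (1%:M : 'M_p) = 1%:M.
Proof. exact: (map_mx1 (intr : {rmorphism int -> R})). Qed.

Lemma toR0 p q : toR (0 : 'M_(p, q)) = 0.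
Proof. exact: (map_mx0 (intr : {rmorphism int -> R})). Qed.

Lemma toRD p q (A B : 'M[int]_(p, q)) : toR (A + B) = toR A + toR B.
Proof. exact: (map_mxD (intr : {rmorphism int -> R})). Qed.

Lemma toRZ p q c (A : 'M[int]_(p, q)) : toR (c *: A) = c%:~R *: toR A.
Proof. exact: (map_mxZ (intr : {rmorphism int -> R})). Qed.

Lemma toRT p q (A : 'M[int]_(p, q)) : toR A^T = (toR A)^T.
Proof. by apply/matrixP => i j; rewrite !mxE. Qed.

Lemma toRMn p q (A : 'M[int]_(p, q)) m : toR (A *+ m) = toR A *+ m.
Proof. by elim: m => [|m IH]; rewrite ?mulr0n ?toR0 // !mulrS toRD IH. Qed.

Lemma toR_sum (I : Type) (r : seq I) p q (F : I -> 'M[int]_(p, q)) :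
  toR (\sum_(i <- r) F i) = \sum_(i <- r) toR (F i).
Proof. by elim: r => [|i r IH]; rewrite ?big_nil ?toR0 // !big_cons toRD IH. Qed.

(** Both factors stop before degree 4, so all degrees of the product are below 8. *)
Lemma exp_conv n p (f : nat -> 'M[R]_n) (g : nat -> 'M[R]_(n, p)) (s t : R) :
  (forall k, (4 <= k)%N -> f k = 0) -> (forall k, (4 <= k)%N -> g k = 0) ->
  (\sum_(i < 4) s ^+ i *: f i) *m (\sum_(j < 4) t ^+ j *: g j) =
  \sum_(k < 8) \sum_(i < k.+1) (s ^+ i * t ^+ (k - i)) *: (f i *m g (k - i)%N).
Proof.
move=> f0 g0.
rewrite -(@convolution _ 4 (fun i j => (s ^+ i * t ^+ j) *: (f i *m g j))); last first.
  by move=> i j /orP[/f0->|/g0->]; rewrite ?mul0mx ?mulmx0 scaler0.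
rewrite mulmx_suml; apply: eq_bigr => i _; rewrite mulmx_sumr; apply: eq_bigr => j _.
by rewrite -scalemxAl -scalemxAr scalerA.
Qed.
End ScalarExtension.

Section RootElements.
Variable D : rootdata.
Local Notation n := (ldim D).
Local Notation nr := (nroots D).
Hypothesis ok : tables_ok D (ads D).
Variable R : comNzRingType.
Local Notation toR := (@toR R _ _).

Definition dp a k : 'M[R]_n := toR (adpowZ D a k).
(** Convertible to [xr] over a field, but available over every commutative ring. *)
Definition xroot (a : nat) (t : R) : 'M[R]_n := \sum_(k < n) t ^+ k *: dp a k.

Lemma dp_ge4 a k : (a < nr)%N -> (4 <= k)%N -> dp a k = 0.
Proof. by move=> lta le; rewrite /dp adpowZ_ge4 // toR0. Qed.

Lemma dp0 a : dp a 0 = 1%:M.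
Proof. by rewrite /dp adpowZ0 toR1. Qed.

Lemma dp_mul a i j : (a < nr)%N -> dp a i *m dp a j = dp a (i + j) *+ 'C(i + j, i).
Proof. by move=> lta; rewrite /dp -toRM adpowZ_mul // toRMn. Qed.

Lemma xroot_sum m a t : (a < nr)%N -> (4 <= m)%N -> xroot a t = \sum_(k < m) t ^+ k *: dp a k.
Proof.
move=> lta; suff H k : (4 <= k)%N ->
    \sum_(i < k) t ^+ i *: dp a i = \sum_(i < 4) t ^+ i *: dp a i.
  by move=> le; rewrite (H m le) -(H _ (ldim_ge4 ok)).
move=> le; rewrite [RHS](big_ord_widen k (fun i => t ^+ i *: dp a i) le).
rewrite [LHS](bigID (fun i : 'I_k => (i < 4)%N)) /= [X in _ + X]big1 ?addr0 // => i.
by rewrite -leqNgt => /(dp_ge4 lta)->; rewrite scaler0.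
Qed.

Lemma xrootD a s t : (a < nr)%N -> xroot a s *m xroot a t = xroot a (s + t).
Proof.
move=> lta; rewrite (@xroot_sum 8 _ (s + t)) // !(@xroot_sum 4) //.
rewrite exp_conv; try by move=> k; apply: dp_ge4.
apply: eq_bigr => k _; rewrite addrC exprDn scaler_suml; apply: eq_bigr => i _.
rewrite dp_mul // subnKC; last by rewrite -ltnS.
by rewrite -scaler_nat scalerA mulr_natr [s ^+ _ * _]mulrC.
Qed.

Lemma xroot0 a : xroot a 0 = 1%:M.
Proof.
rewrite /xroot; move: (ldim_ge4 ok); case: n (dp a) (dp0 a) => // m f f0 _.
rewrite big_ord_recl expr0 scale1r f0 big1 ?addr0 // => i _.
by rewrite expr0n scale0r.
Qed.

Lemma xrootK a t : (a < nr)%N -> xroot a (- t) *m xroot a t = 1%:M.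
Proof. by move=> lta; rewrite xrootD // addNr xroot0. Qed.

Lemma xrootVK a t : (a < nr)%N -> xroot a t *m xroot a (- t) = 1%:M.
Proof. by move=> lta; rewrite xrootD // addrN xroot0. Qed.

(** The Lie algebra operator ad y = [y, .], linear in the coordinate vector [y]. *)
Definition Ad (y : 'cV[R]_n) : 'M[R]_n := \sum_(k < n) y k 0 *: toR (adk D k).

Lemma AdD u v : Ad (u + v) = Ad u + Ad v.
Proof. by rewrite -big_split; apply: eq_bigr => k _; rewrite mxE scalerDl. Qed.

Lemma AdZ c u : Ad (c *: u) = c *: Ad u.
Proof. by rewrite scaler_sumr; apply: eq_bigr => k _; rewrite mxE scalerA. Qed.

Lemma Ad0 : Ad 0 = 0.
Proof. by rewrite -[0](scale0r 0) AdZ scale0r. Qed.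

Lemma Ad_sum (I : Type) (r : seq I) (F : I -> 'cV[R]_n) :
  Ad (\sum_(i <- r) F i) = \sum_(i <- r) Ad (F i).
Proof. by elim: r => [|i r IH]; rewrite ?big_nil ?Ad0 // !big_cons AdD IH. Qed.

Lemma AdMn u m : Ad (u *+ m) = Ad u *+ m.
Proof. by rewrite -!scaler_nat AdZ. Qed.

Lemma Ad_anti u v : Ad u *m v = - (Ad v *m u).
Proof.
have AdE w z : Ad w *m z = \col_r \sum_k \sum_l w k 0 * ((adk D k r l)%:~R * z l 0).
  apply/colP => r; rewrite mulmx_suml summxE mxE; apply: eq_bigr => k _.
  rewrite -scalemxAl !mxE mulr_sumr; apply: eq_bigr => l _; by rewrite !mxE.
rewrite !AdE; apply/colP => r; rewrite !mxE exchange_big -sumrN; apply: eq_bigr => k _.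
rewrite -sumrN; apply: eq_bigr => l _.
by rewrite (adk_anti ok) rmorphN mulNr mulrN mulrC -mulrA mulrCA mulrC -mulrA.
Qed.

Lemma Ad_jacobi a y : (a < nr)%N ->
  dp a 1 *m Ad y = Ad (dp a 1 *m y) + Ad y *m dp a 1.
Proof.
move=> lta; rewrite /dp adpowZ1 // /Ad mulmx_sumr mulmx_suml.
transitivity (\sum_(k < n) (y k 0 *: (\sum_(l < n) (adk D a l k)%:~R *: toR (adk D l))
   + y k 0 *: toR (adk D k) *m toR (adk D a))).
  apply: eq_bigr => k _; rewrite -scalemxAr -toRM (adk_jacobi ok k lta) toRD scalerDr.
  congr (_ *: _ + _); last by rewrite toRM scalemxAl.
  by rewrite toR_sum; apply: eq_bigr => l _; rewrite toRZ.
rewrite big_split /=; congr (_ + _).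
under eq_bigr => k _ do rewrite scaler_sumr.
rewrite exchange_big; apply: eq_bigr => l _; rewrite mxE scaler_suml.
by apply: eq_bigr => k _; rewrite !mxE scalerA mulrC.
Qed.

Hypothesis tf : torsion_free R.

Lemma dpS a k : (a < nr)%N -> dp a 1 *m dp a k = dp a k.+1 *+ k.+1.
Proof. by move=> lta; rewrite dp_mul // add1n bin1. Qed.

(** Leibniz rule for divided powers of the derivation ad e_a. Applying ad e_a to the case k gives k
    + 1 times the case k + 1, and torsion-freeness divides. *)
Lemma Ad_leibniz a k y : (a < nr)%N ->
  dp a k *m Ad y = \sum_(i < k.+1) Ad (dp a i *m y) *m dp a (k - i).
Proof.
move=> lta; elim: k => [|k IH]; first by rewrite big_ord1 subnn dp0 mul1mx mulmx1 mul1mx.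
apply: (mx_torsion tf (m := k)); rewrite -mulMnl -dpS // -mulmxA IH mulmx_sumr.
transitivity (\sum_(i < k.+1) ((Ad (dp a i.+1 *m y) *m dp a (k - i)) *+ i.+1 +
    (Ad (dp a i *m y) *m dp a (k - i).+1) *+ (k - i).+1)).
  apply: eq_bigr => i _; rewrite mulmxA Ad_jacobi // mulmxDl; congr (_ + _).
    by rewrite mulmxA dpS // mulMnl AdMn mulMnl.
  by rewrite -mulmxA dpS // mulMnr.
rewrite big_split /= -[RHS]sumrMnl.
(* The factor k + 1 is split as i + (k + 1 - i), one part for each way of raising an exponent. *)
have -> : \sum_(i < k.+2) (Ad (dp a i *m y) *m dp a (k.+1 - i)) *+ k.+1 =
  \sum_(i < k.+2) (Ad (dp a i *m y) *m dp a (k.+1 - i)) *+ i +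
  \sum_(i < k.+2) (Ad (dp a i *m y) *m dp a (k.+1 - i)) *+ (k.+1 - i).
  by rewrite -big_split; apply: eq_bigr => i _; rewrite /= -mulrnDr subnKC // -ltnS.
congr (_ + _); first by rewrite [RHS]big_ord_recl mulr0n add0r.
rewrite [RHS]big_ord_recr /= subnn mulr0n addr0.
by apply: eq_bigr => i _; rewrite subSn // -ltnS.
Qed.

(** The exponential of a derivation is an automorphism: this is the Leibniz rule summed over all
    degrees. *)
Lemma xroot_Ad a t y : (a < nr)%N ->
  xroot a t *m Ad y = Ad (xroot a t *m y) *m xroot a t.
Proof.
move=> lta; rewrite {1}(@xroot_sum 8) // !(@xroot_sum 4) //.
have -> : Ad ((\sum_(k < 4) t ^+ k *: dp a k) *m y) =
          \sum_(k < 4) t ^+ k *: Ad (dp a k *m y).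
  rewrite mulmx_suml Ad_sum; apply: eq_bigr => k _.
  by rewrite -scalemxAl AdZ.
rewrite (@exp_conv _ _ _ (fun k => Ad (dp a k *m y))); last 1 first.
- by move=> k; apply: dp_ge4.
- rewrite mulmx_suml; apply: eq_bigr => k _; rewrite -scalemxAl Ad_leibniz // scaler_sumr.
  by apply: eq_bigr => i _; rewrite -exprD subnKC // -ltnS.
by move=> k le; rewrite dp_ge4 // mul0mx Ad0.
Qed.
End RootElements.

(** * The invariant form *)

Section FormChecks.
Variables (D : rootdata) (T : seq smat) (K : smat).
Let n := ldim D.

(* [s = 1] tests symmetry and [s = -1] antisymmetry, visiting nonzero entries only. *)
Definition mirror (s : int) (M : smat) : bool :=
  all (fun j => all (fun p =>
    (p.1 < n)%N ==> (scoef (scol M p.1) j == s * scoef (scol M j) p.1)) (scol M j)) (iota 0 n).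
(** For symmetric [K], antisymmetry of K ad(x_k) is the invariance of the form under x_k. *)
Definition form_ok : bool :=
  [&& size K == n, mirror 1 K & all (fun k => mirror (-1) (smul K (nth [::] T k))) (iota 0 n)].
(** For e_al, e_be in [tops]: they commute, are orthogonal, and ad e_al ad e_be = - (e_al K(e_be, .)
    + e_be K(e_al, .)). The first clause disposes of the cubic term of x_{a0}(1): either it is zero,
    or [tops] is a singleton and skewness applies. *)
Definition core_ok (a0 : nat) (tops : seq nat) : bool :=
  ((nth [::] (dpow D (nth [::] T a0)) 3 == nseq n [::]) || (size tops == 1)%N) &&
  all (fun al => let Ta := nth [::] T al in all (fun be => let Tb := nth [::] T be in
     [&& scol Tb al == [::], scoef (scol K be) al == 0 &
     all (fun y => nform (sapp Ta (scol Tb y)) ==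
        nform [:: (al, - scoef (scol K y) be); (be, - scoef (scol K y) al)]) (iota 0 n)]) tops) tops.
End FormChecks.

Lemma scoef_mem v r : scoef v r != 0 -> exists2 p, p \in v & p.1 = r.
Proof.
elim: v => [|p v IH]; first by rewrite eqxx.
rewrite scoef_cons; case: (eqVneq p.1 r) => [E _|_].
  by exists p; rewrite ?mem_head.
by rewrite mul0r add0r => /IH[q qv E]; exists q; rewrite // inE qv orbT.
Qed.

(** If either of the two mirrored entries is nonzero, the test made there settles the equation, read
    backwards by s * s = 1 if necessary. *)
Lemma mirrorP D s M i j : s * s = 1 -> mirror D s M -> (i < ldim D)%N -> (j < ldim D)%N ->
  scoef (scol M i) j = s * scoef (scol M j) i.
Proof.
move=> ss /allnP H.
have key k l : (k < ldim D)%N -> (l < ldim D)%N -> scoef (scol M l) k != 0 ->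
    scoef (scol M k) l = s * scoef (scol M l) k.
  move=> ltk ltl /scoef_mem[p pM E]; have /allP/(_ p pM) := H l ltl.
  by rewrite E ltk => /eqP.
move=> lti ltj; have [E|ne] := eqVneq (scoef (scol M j) i) 0; last exact: key.
have [->|ne] := eqVneq (scoef (scol M i) j) 0; first by rewrite E mulr0.
by rewrite (key j i) // mulrA ss mul1r.
Qed.

Section Form.
Variable D : rootdata.
Local Notation n := (ldim D).
Local Notation nr := (nroots D).
Hypothesis ok : tables_ok D (ads D).
Variable Ks : smat.
Hypothesis fok : form_ok D (ads D) Ks.
Variable R : comNzRingType.
Local Notation toR := (@toR R _ _).
Local Notation dp := (dp D R).
Local Notation xroot := (@xroot D R).

Definition svc (v : svec) : 'cV[R]_n := \col_r (scoef v r)%:~R.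
Definition bas k : 'cV[R]_n := svc [:: (k, 1)].
Definition Kr : 'M[R]_n := toR (smx n Ks).

Lemma smx_svc M v : size M = n -> toR (smx n M) *m svc v = svc (sapp M v).
Proof.
move=> sM; apply/colP => r; rewrite !mxE (scoef_sapp _ _ sM) rmorph_sum.
by apply: eq_bigr => k _; rewrite !mxE rmorphM.
Qed.

Lemma smx_bas M k : size M = n -> toR (smx n M) *m bas k = svc (scol M k).
Proof.
move=> sM; rewrite smx_svc //; apply/colP => r.
by rewrite !mxE scoef_cat scoef_scale mul1r addr0.
Qed.

Lemma Ad_bas k : (k < n)%N -> Ad (bas k) = toR (adk D k).
Proof.
move=> ltk; rewrite /Ad (bigD1 (Ordinal ltk)) //= mxE scoef_cons /= eqxx scale1r.
rewrite big1 ?addr0 // => i; rewrite -val_eqE /= => /negPf ne.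
by rewrite mxE scoef_cons /= eq_sym ne scale0r.
Qed.

Lemma Kr_sym : Kr^T = Kr.
Proof.
case/and3P: fok => _ sym _; apply/matrixP => i j; rewrite !mxE.
by rewrite (@mirrorP D 1 Ks) // mul1r.
Qed.

Lemma Kr_adk (k : 'I_n) : Kr *m toR (adk D k) = - (toR (adk D k))^T *m Kr.
Proof.
case/and3P: fok => /eqP sK _ /allnP/(_ k (ltn_ord k)) H.
rewrite -{2}Kr_sym mulNmx -trmx_mul /Kr -toRM -toRT -smx_mul //; apply/matrixP => i j.
by rewrite !mxE (@mirrorP D (-1) _ _ _ _ H) // mulN1r rmorphN.
Qed.

Lemma Kr_Ad y : Kr *m Ad y = - (Ad y)^T *m Kr.
Proof.
rewrite /Ad mulmx_sumr raddf_sum mulNmx mulmx_suml -sumrN; apply: eq_bigr => k _.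
by rewrite -scalemxAr Kr_adk mulNmx scalerN /= [(_ *: _)^T]linearZ /= -scalemxAl.
Qed.

Hypothesis tf : torsion_free R.

(** ad e_a is skew for the form, so its powers acquire the sign (-1)^k; the induction divides by k +
    1. *)
Lemma Kr_dp a k : (a < nr)%N -> Kr *m dp a k = (-1) ^+ k *: ((dp a k)^T *m Kr).
Proof.
move=> lta; elim: k => [|k IH]; first by rewrite dp0 // trmx1 mulmx1 mul1mx scale1r.
have e1 : dp a 1 = toR (adk D (Ordinal (ltn_ldim lta))) by rewrite /dp adpowZ1.
apply: (mx_torsion tf (m := k)).
rewrite -mulMnr -[in LHS](dpS ok) // mulmxA {1}e1 Kr_adk -e1 !mulNmx -mulmxA IH.
rewrite -scalemxAr mulmxA -trmx_mul.
rewrite (_ : dp a k *m dp a 1 = dp a k.+1 *+ k.+1); last first.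
  by rewrite dp_mul // addn1 binSn.
by rewrite exprS mulN1r scaleNr raddfMn mulMnl mulNrn scalerMnr.
Qed.

Lemma xroot_form a t : (a < nr)%N -> (xroot a t)^T *m Kr = Kr *m xroot a (- t).
Proof.
move=> lta; rewrite /xroot raddf_sum mulmx_suml mulmx_sumr; apply: eq_bigr => k _.
rewrite /= [(_ *: _)^T]linearZ /= -scalemxAl -scalemxAr Kr_dp // scalerA [(- t) ^+ _]exprNn mulrAC -exprD addnn.
by rewrite -mul2n exprM sqrrN !expr1n mul1r.
Qed.

(** Group elements are handled as words, because the parameters of a word can be lifted to another
    ring. *)
Definition gw (w : seq (nat * R)) : 'M[R]_n := foldr (fun l M => xroot l.1 l.2 *m M) 1%:M w.
Definition roots_in (w : seq (nat * R)) := all (fun l => l.1 < nr)%N w.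
Definition winv (w : seq (nat * R)) : seq (nat * R) := rev [seq (l.1, - l.2) | l <- w].

Lemma gw_Ad w y : roots_in w -> gw w *m Ad y = Ad (gw w *m y) *m gw w.
Proof.
elim: w y => [|l w IH] y /=; first by rewrite mul1mx mulmx1 mul1mx.
by case/andP=> ltl win; rewrite -mulmxA IH // mulmxA (xroot_Ad ok tf) // -!mulmxA.
Qed.

Lemma gw_form w : roots_in w -> (gw w)^T *m Kr *m gw w = Kr.
Proof.
elim: w => [|l w IH] /=; first by rewrite trmx1 mul1mx mulmx1.
case/andP=> ltl win; rewrite trmx_mul -(mulmxA (gw w)^T) xroot_form //.
by rewrite !mulmxA -(mulmxA _ (xroot l.1 (- l.2)) (xroot l.1 l.2)) xrootK // mulmx1 IH.
Qed.
End Form.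

Section GroupWords.
Variable D : rootdata.
Local Notation n := (ldim D).
Local Notation nr := (nroots D).
Hypothesis ok : tables_ok D (ads D).
Variable R : comNzRingType.

Lemma gw_cat (u v : seq (nat * R)) : gw D (u ++ v) = gw D u *m gw D v.
Proof. by elim: u => [|l u IH]; rewrite ?mul1mx //= IH mulmxA. Qed.

Lemma roots_winv (w : seq (nat * R)) : roots_in D (winv w) = roots_in D w.
Proof. by rewrite /roots_in all_rev all_map. Qed.

Lemma winvK (w : seq (nat * R)) : winv (winv w) = w.
Proof.
rewrite /winv map_rev revK -map_comp -[RHS]map_id; apply: eq_map => -[a t] /=.
by rewrite opprK.
Qed.

Lemma gw_winv (w : seq (nat * R)) : roots_in D w -> gw D (winv w) *m gw D w = 1%:M.
Proof.
elim: w => [|l w IH] /=; first by rewrite mulmx1.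
case/andP=> ltl win; rewrite /winv /= rev_cons -cats1 gw_cat /= mulmx1.
by rewrite -mulmxA (mulmxA (xroot _ _ _)) xrootK // mul1mx IH.
Qed.

Lemma gw_winvr (w : seq (nat * R)) : roots_in D w -> gw D w *m gw D (winv w) = 1%:M.
Proof. by move=> win; rewrite -{1}[w]winvK gw_winv // roots_winv. Qed.
End GroupWords.

(** * The rank one identity *)

Section Core.
Variable D : rootdata.
Local Notation n := (ldim D).
Local Notation nr := (nroots D).
Hypothesis ok : tables_ok D (ads D).
Variable Ks : smat.
Hypothesis fok : form_ok D (ads D) Ks.
Variables (a0 : nat) (tops : seq nat).
Hypothesis cok : core_ok D (ads D) Ks a0 tops.
Hypotheses (a0r : (a0 < nr)%N) (topsr : all (fun a => a < nr)%N tops).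

Section Ring.
Variable R : comNzRingType.
Local Notation toR := (@toR R _ _).
Local Notation dp := (dp D R).
Local Notation xroot := (@xroot D R).
Local Notation Kr := (@Kr D Ks R).
Local Notation bas := (@bas D R).

Lemma core_bas al be : al \in tops -> be \in tops ->
  [/\ Ad (bas be) *m bas al = 0, (bas al)^T *m Kr *m bas be = 0 &
  Ad (bas al) *m Ad (bas be) =
    - (bas al *m ((bas be)^T *m Kr) + bas be *m ((bas al)^T *m Kr))].
Proof.
move=> alT beT; have [alr ber] := (allP topsr _ alT, allP topsr _ beT).
case/andP: cok => _ /allP/(_ _ alT)/allP/(_ _ beT)/and3P[/eqP c1 /eqP c2 /allnP c3].
have [lal lbe] := (ltn_ldim alr, ltn_ldim ber).
have [sal sbe] := (size_ads ok lal, size_ads ok lbe).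
have sK : size Ks = n by case/and3P: fok => /eqP.
have bK a (c : 'I_n) : (a < n)%N -> ((bas a)^T *m Kr) 0 c = (scoef (scol Ks c) a)%:~R.
  move=> lta; rewrite mxE (bigD1 (Ordinal lta)) //= !mxE scoef1 eqxx !mul1r.
  rewrite big1 ?addr0 // => i; rewrite -val_eqE /= => /negPf ne.
  by rewrite !mxE scoef1 eq_sym ne !mul0r.
split.
- by rewrite Ad_bas // smx_bas // c1; apply/colP => r; rewrite !mxE.
- rewrite -mulmxA smx_bas //; apply/matrixP => i j; rewrite !ord1 mxE.
  rewrite (bigD1 (Ordinal lal)) //= !mxE scoef1 eqxx !mul1r c2.
  rewrite big1 ?addr0 // => k; rewrite -val_eqE /= => /negPf ne.
  by rewrite !mxE scoef1 eq_sym ne !mul0r.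
rewrite !Ad_bas // -toRM -smx_mul //; apply/matrixP => r c; rewrite !mxE scol_map //.
rewrite scoef_nform (scoef_nform_eq _ (eqP (c3 c (ltn_ord c)))) scoef_cons scoef1 /=.
rewrite !big_ord1 !bK // !mxE !scoef1 !mulr1 !mulrN !rmorphD !rmorphN.
by rewrite !rmorphM opprD.
Qed.

Hypothesis tf : torsion_free R.

(** Expand x_{a0}(1) in divided powers: degrees 0, 1 and 3 contribute nothing, and degree 2 gives
    the right-hand side. *)
Lemma core_identity al be (g h : 'M[R]_n) : al \in tops -> be \in tops ->
  (forall y, g *m Ad y = Ad (g *m y) *m g) -> g^T *m Kr *m g = Kr ->
  g *m h = 1%:M ->
  (g *m bas al)^T *m Kr *m (xroot a0 1 *m (g *m bas be)) =
  - (((g *m bas al)^T *m Kr *m bas a0) *m ((g *m bas be)^T *m Kr *m bas a0)).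
Proof.
move=> alT beT gA gK gh.
have [c1 c2 c3] := core_bas alT beT.
set v := g *m bas al; set w := g *m bas be; set e := bas a0.
have tr1 (M : 'M[R]_1) : M^T = M by apply/matrixP => i j; rewrite !ord1 mxE.
have com1 (A B : 'M[R]_1) : A *m B = B *m A.
  by rewrite [A]mx11_scalar [B]mx11_scalar -!scalar_mxM mulrC.
have symm (u1 u2 : 'cV[R]_n) : u1^T *m Kr *m u2 = u2^T *m Kr *m u1.
  by rewrite -[LHS]trmxK tr1 !trmx_mul trmxK (Kr_sym fok) mulmxA.
have invA y (u1 u2 : 'cV[R]_n) :
    u1^T *m Kr *m (Ad y *m u2) = - ((Ad y *m u1)^T *m Kr *m u2).
  by rewrite -(mulmxA u1^T) (mulmxA Kr) (Kr_Ad fok) !mulNmx mulmxN trmx_mul !mulmxA.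
have Kh : Kr *m h = g^T *m Kr by rewrite -{1}gK -!mulmxA gh mulmx1.
have e1 : dp a0 1 = Ad e by rewrite Ad_bas ?ltn_ldim // /dp adpowZ1.
have t0 : v^T *m Kr *m w = 0.
  by rewrite trmx_mul -[RHS]c2 -[in RHS]gK !mulmxA.
have Awv : Ad w *m v = 0 by rewrite mulmxA -gA -mulmxA c1 mulmx0.
(* K(v, [e, w]) = K([w, v], e), and v, w commute. *)
have t1 : v^T *m Kr *m (dp a0 1 *m w) = 0.
  by rewrite e1 (Ad_anti ok) mulmxN invA Awv trmx0 !mul0mx !oppr0.
(* Twice the left-hand side is K(v, [e, [e, w]]) = K(e, [v, [w, e]]), which is evaluated by the
   product formula of [core_bas] transported by [g]. *)
have t2 : v^T *m Kr *m (dp a0 2 *m w) = - ((v^T *m Kr *m e) *m (w^T *m Kr *m e)).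
  have AvAw : Ad v *m (Ad w *m e) = - (v *m (w^T *m Kr *m e) + w *m (v^T *m Kr *m e)).
    have -> : Ad v *m (Ad w *m e) = g *m (Ad (bas al) *m Ad (bas be) *m (h *m e)).
      rewrite -{1}[e]mul1mx -gh -(mulmxA g h) (mulmxA (Ad w)) -gA -(mulmxA g) (mulmxA (Ad v)).
      by rewrite -gA -!mulmxA.
    rewrite c3 mulNmx mulmxN mulmxDl mulmxDr -!(mulmxA _ _ (h *m e)).
    by rewrite !(mulmxA Kr h) Kh /v /w !trmx_mul !mulmxA.
  apply: (mx_torsion tf (m := 1)); rewrite -mulMnr -mulMnl -(dpS ok) //.
  rewrite -(mulmxA (dp a0 1)) e1 invA.
  rewrite ![Ad e *m _](Ad_anti ok) mulmxN [(- _)^T]raddfN !mulNmx opprK -invA AvAw.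
  rewrite mulmxN mulmxDr (mulmxA (e^T *m Kr) v) (mulmxA (e^T *m Kr) w) [e^T *m Kr *m v]symm.
  rewrite [e^T *m Kr *m w]symm.
  by rewrite [(w^T *m Kr *m e) *m _]com1 mulr2n opprD.
(* If the cubic divided power is nonzero, then w = v, and an operator skew for the form has K(v, A
   v) = 0 up to the factor 2. *)
have t3 : v^T *m Kr *m (dp a0 3 *m w) = 0.
  case/andP: cok => /orP[/eqP z|/eqP sz] _.
    by rewrite /dp (proj1 (adpowZ_dpow ok 3 a0r)) z smx_nseq toR0 mul0mx mulmx0.
  have -> : w = v.
    move: alT beT sz; rewrite /v /w; case: tops => [|x [|y s]] //.
    by rewrite !inE => /eqP-> /eqP->.
  apply: (mx_torsion tf (m := 1)); rewrite mul0rn mulr2n.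
  have {1}-> : v^T *m Kr *m (dp a0 3 *m v) = - (v^T *m Kr *m (dp a0 3 *m v)).
    rewrite {1}mulmxA -(mulmxA v^T) (Kr_dp ok fok tf) // -scalemxAr -scalemxAl.
    by rewrite (mulmxA v^T) -trmx_mul symm -signr_odd expr1 scaleN1r.
  by rewrite addNr.
rewrite (@xroot_sum _ ok _ 4) // !big_ord_recr big_ord0 /= !expr1n !scale1r add0r dp0 //.
by rewrite !mulmxDl !mulmxDr mul1mx t0 t1 t2 t3 addr0 !add0r.
Qed.
End Ring.
End Core.

(* The ring is Z[X_1, ..., X_m]. *)
Lemma torsion_free_lift (F : comNzRingType) (ts : seq F) :
  exists (R : comNzRingType) (phi : {rmorphism R -> F}) (us : seq R),
    torsion_free R /\ [seq phi u | u <- us] = ts.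
Proof.
elim: ts => [|t ts [R [phi [us [tf E]]]]].
  by exists int, (intr : {rmorphism int -> F}), [::]; split=> //; apply: int_tf.
exists {poly R}, (horner_eval t \o map_poly phi : {rmorphism {poly R} -> F}).
exists ('X :: [seq u%:P | u <- us]); split=> [m p /polyP H|].
  by apply/polyP => i; rewrite coef0; apply: (tf m); rewrite -coefMn H coef0.
rewrite /= /horner_eval map_polyX hornerX -map_comp -E; congr (_ :: _).
by apply: eq_map => u /=; rewrite map_polyC hornerC.
Qed.

(** * Base change along ring homomorphisms *)

Section Specialize.
Variable D : rootdata.
Local Notation n := (ldim D).
Variables (R F : comNzRingType) (phi : {rmorphism R -> F}).

Lemma map_toR p q (M : 'M[int]_(p, q)) : map_mx phi (toR R M) = toR F M.
Proof. by apply/matrixP => i j; rewrite !mxE rmorph_int. Qed.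

Lemma map_bas k : map_mx phi (bas D R k) = bas D F k.
Proof. by apply/matrixP => i j; rewrite !mxE rmorph_int. Qed.

Lemma map_xroot a t : map_mx phi (xroot D a t) = xroot D a (phi t).
Proof.
rewrite map_mx_sum; apply: eq_bigr => k _.
by rewrite map_mxZ rmorphXn map_toR.
Qed.

Lemma map_gw w : map_mx phi (gw D w) = gw D [seq (l.1, phi l.2) | l <- w].
Proof. by elim: w => [|l w IH] /=; rewrite ?map_mx1 // map_mxM IH map_xroot. Qed.
End Specialize.

Section CoreField.
Variable D : rootdata.
Hypothesis ok : tables_ok D (ads D).
Variable Ks : smat.
Hypothesis fok : form_ok D (ads D) Ks.
Variables (a0 : nat) (tops : seq nat).
Hypothesis cok : core_ok D (ads D) Ks a0 tops.
Hypotheses (a0r : (a0 < nroots D)%N) (topsr : all (fun a => a < nroots D)%N tops).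
Variable F : comNzRingType.
Local Notation bas := (bas D F).
Local Notation Kr := (Kr D Ks F).

(** Identities of words proved over a torsion-free ring descend along [phi] to all
    characteristics. *)
Lemma word_lift (w : seq (nat * F)) : roots_in D w ->
  exists (R : comNzRingType) (phi : {rmorphism R -> F}) (w' : seq (nat * R)),
  [/\ torsion_free R, roots_in D w' &
      map_mx phi (gw D w') = gw D w].
Proof.
move=> win; have [R [phi [us [tf E]]]] := torsion_free_lift (unzip2 w).
have su : size us = size w by rewrite -(size_map phi) E size_map.
pose w' := zip (unzip1 w) us.
have Ew : [seq (l.1, phi l.2) | l <- w'] = w.
  rewrite -[RHS]zip_unzip -E /w'.
  have : size (unzip1 w) = size us by rewrite size_map.
  by elim: (unzip1 w) us {E su w'} => [|a s IH] [|u us] //= [sz]; rewrite IH.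
exists R, phi, w'; split=> //; first by move: win; rewrite -{1}Ew /roots_in all_map.
by rewrite map_gw Ew.
Qed.

Lemma gw_form_any w : roots_in D w -> (gw D w)^T *m Kr *m gw D w = Kr.
Proof.
case/word_lift => R [phi [w' [tf win <-]]].
move/(congr1 (map_mx phi)): (gw_form ok fok tf win).
by rewrite !(map_mxM, =^~ map_trmx) !map_toR.
Qed.

Lemma core_identity_any w al be : roots_in D w -> al \in tops -> be \in tops ->
  (gw D w *m bas al)^T *m Kr *m (xroot D a0 1 *m (gw D w *m bas be)) =
  - (((gw D w *m bas al)^T *m Kr *m bas a0) *m ((gw D w *m bas be)^T *m Kr *m bas a0)).
Proof.
case/word_lift => R [phi [w' [tf win <-]]] alT beT.
have := core_identity ok fok cok a0r topsr tf alT beT (fun y => gw_Ad ok tf y win)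
  (gw_form ok fok tf win) (gw_winvr ok win).
move/(congr1 (map_mx phi)).
by rewrite !(map_mxM, map_mxN, =^~ map_trmx) map_xroot !map_bas /Kr !map_toR rmorph1.
Qed.
End CoreField.

(** * Integral words *)

Section WordChecks.
Variables (D : rootdata) (T : seq smat).
Let n := ldim D.
Let nr := nroots D.

Definition zexp (c : int) k : int := iter k (intRing.mulz c) 1.
Definition sx (dps : seq smat) (c : int) : smat :=
  mkseq (fun j => nform (flatten
    [seq sscale (zexp c k) (scol (nth [::] dps k) j) | k <- iota 0 4])) n.
Definition wmat (w : seq (nat * int)) : smat :=
  foldr (fun l M => smul (sx (dpow D (nth [::] T l.1)) l.2) M) (sid n) w.

(** The middle parameter is -c in place of -1/c, so this is the word of [wr] only for c = 1 or
    -1. *)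
Definition wrword (c : int) a : seq (nat * int) := [:: (a, c); (neg D a, - c); (a, c)].
Definition wrtab : seq smat := [seq wmat (wrword 1 (simple D i)) | i <- iota 0 (rk D)].
(** The root s_j(b), read off from the column of w_j(1) at e_b. *)
Definition step (Ns : seq smat) j b : nat :=
  if scol (nth [::] Ns j) b is p :: _ then p.1 else b.
Definition step_ok (Ns : seq smat) : bool :=
  all (fun j => all (fun b =>
    let v := scol (nth [::] Ns j) b in
    (step Ns j b < nr)%N &&
    ((v == [:: (step Ns j b, 1)]) || (v == [:: (step Ns j b, -1)]))) (iota 0 nr)) (iota 0 (rk D)).
Definition ht b : int := foldr intZmod.addz 0 (rootv D b).
(* Greedy descent by simple reflections ends at the antidominant root of the W-orbit. *)
Fixpoint lowest (Ns : seq smat) fuel b : nat :=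
  if fuel is f.+1 then
    if [seq c <- [seq step Ns j b | j <- iota 0 (rk D)] | ht c < ht b] is c :: _
    then lowest Ns f c else b
  else b.
Definition shortb a : bool :=
  has (fun b => bilc D (rootv D a) (rootv D a) < bilc D (rootv D b) (rootv D b)) (iota 0 nr).
(** All short roots descend to [a0], so the w_j connect them. Each descent lowers the height and
    reaches a new root, hence the fuel [nr] suffices. *)
Definition short_ok a0 : bool :=
  let Ns := wrtab in
  step_ok Ns && all (fun a => shortb a ==> (lowest Ns nr a == a0)) (iota 0 nr).

(** Two gradings of the Lie algebra, by the alpha_i-coefficient and by the pairing with the coroot
    of alpha_i; the Cartan part has degree 0. *)
Definition dcoef i r : int := if (r < nr)%N then rcoef D r i else 0.
Definition dpair i r : int := if (r < nr)%N then pairingc D r i else 0.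
Definition homs (d : nat -> int) (k : int) (M : smat) : bool :=
  all (fun c => all (fun p => d p.1 == d c + k) (scol M c)) (iota 0 n).
(** The condition on w_i(1) expresses s_i(c) = c + <s_i(c), alpha_i^vee> alpha_i in the coefficient
    of alpha_i. The last clause lets the torus at [i0] rescale the root subgroup of [a0]. *)
Definition torus_ok i0 a0 : bool :=
  all (fun i => let s := simple D i in
   [&& (s < nr)%N, (neg D s < nr)%N, homs (dcoef i) 1 (nth [::] T s),
      homs (dcoef i) (-1) (nth [::] T (neg D s)) &
    all (fun c => all (fun p => dcoef i p.1 == dcoef i c + dpair i p.1)
      (scol (wmat (wrword 1 s)) c)) (iota 0 n)])
   (iota 0 (rk D)) && homs (dpair i0) (-1) (nth [::] T a0).
End WordChecks.

Lemma zexpE c k : zexp c k = c ^+ k.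
Proof. by elim: k => [|k IH] //=; rewrite exprS -IH. Qed.

Section Words.
Variable D : rootdata.
Local Notation n := (ldim D).
Local Notation nr := (nroots D).
Local Notation T := (ads D).
Hypothesis ok : tables_ok D T.

Definition wcast (F : comNzRingType) (w : seq (nat * int)) : seq (nat * F) :=
  [seq (l.1, l.2%:~R) | l <- w].

Lemma roots_wcast (F : comNzRingType) w : roots_in D (wcast F w) = roots_in D w.
Proof. by rewrite /roots_in all_map. Qed.

Lemma size_wmat w : size (wmat D T w) = n.
Proof. by elim: w => [|l w IH] /=; rewrite ?size_mkseq // size_smul. Qed.

Lemma smx_sx (F : comNzRingType) a c : (a < nr)%N ->
  toR F (smx n (sx D (dpow D (nth [::] T a)) c)) = xroot D a (c%:~R : F).
Proof.
move=> lta; rewrite (@xroot_sum _ ok _ 4) //.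
have -> : smx n (sx D (dpow D (nth [::] T a)) c) = \sum_(k < 4) c ^+ k *: adpowZ D a k.
  apply/matrixP => r j; rewrite mxE /scol nth_mkseq // scoef_nform scoef_flatten big_map.
  rewrite summxE -(big_mkord xpredT (fun k => (c ^+ k *: adpowZ D a k) r j)).
  apply: eq_bigr => k _; rewrite scoef_scale zexpE (proj1 (adpowZ_dpow ok k lta)) !mxE.
  by [].
rewrite toR_sum; apply: eq_bigr => k _; by rewrite toRZ rmorphXn.
Qed.

Lemma smx_wmat (F : comNzRingType) w : roots_in D w ->
  toR F (smx n (wmat D T w)) = gw D (wcast F w).
Proof.
elim: w => [|l w IH] /=; first by rewrite smx_id toR1.
by case/andP=> ltl win; rewrite smx_mul ?size_mkseq // toRM IH // smx_sx.
Qed.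

Lemma wmat_eq (F : comNzRingType) u v : roots_in D u -> roots_in D v ->
  wmat D T u == wmat D T v -> gw D (wcast F u) = gw D (wcast F v).
Proof. by move=> uin vin /eqP E; rewrite -!smx_wmat // E. Qed.

Lemma conj_dp (R : comNzRingType) (tf : torsion_free R) (g : 'M[R]_n) b b' c k : (b < nr)%N -> (b' < nr)%N ->
  (forall y, g *m Ad y = Ad (g *m y) *m g) -> g *m bas D R b = c *: bas D R b' ->
  g *m dp D R b k = c ^+ k *: (dp D R b' k *m g).
Proof.
move=> ltb ltb' gA gb.
have e1 a : (a < nr)%N -> dp D R a 1 = Ad (bas D R a).
  by move=> lta; rewrite Ad_bas ?ltn_ldim // /dp adpowZ1.
elim: k => [|k IH]; first by rewrite !dp0 // mulmx1 mul1mx scale1r.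
apply: (mx_torsion tf (m := k)).
rewrite -mulMnr -(dpS ok) // mulmxA e1 // gA gb AdZ -e1 // -!scalemxAl -mulmxA IH.
by rewrite -scalemxAr mulmxA (dpS ok) // mulMnl scalerA exprS scalerMnr.
Qed.

(** The word is integral, so conjugation of divided powers is proved over [int], which is
    torsion-free, and then mapped to [F]. *)
Lemma conj_xroot (F : comNzRingType) w b b' c (t : F) :
  roots_in D w -> (b < nr)%N -> (b' < nr)%N ->
  scol (wmat D T w) b = [:: (b', c)] ->
  gw D (wcast F w) *m xroot D b t = xroot D b' (c%:~R * t) *m gw D (wcast F w).
Proof.
move=> win ltb ltb' col.
have win' : roots_in D (wcast int w) by rewrite roots_wcast.
have gb : gw D (wcast int w) *m bas D int b = c *: bas D int b'.
  rewrite -smx_wmat // smx_bas ?size_wmat // col; apply/colP => r.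
  by rewrite !mxE !scoef1 !intz mulr1 mulrC.
have E k := conj_dp int_tf k ltb ltb' (fun y => gw_Ad ok int_tf y win') gb.
have EF k : gw D (wcast F w) *m dp D F b k = c%:~R ^+ k *: (dp D F b' k *m gw D (wcast F w)).
  move/(congr1 (map_mx (intr : {rmorphism int -> F}))): (E k).
  rewrite map_mxZ !map_mxM map_gw !map_toR rmorphXn -map_comp.
  by rewrite (eq_map (g := fun l => (l.1, l.2%:~R : F))) // => l /=; rewrite intz.
rewrite /xroot mulmx_sumr mulmx_suml; apply: eq_bigr => k _.
by rewrite -scalemxAr EF scalerA -scalemxAl exprMn mulrC.
Qed.
End Words.

(** * Gradings and the torus *)

Section Torus.
Variable D : rootdata.
Local Notation n := (ldim D).
Local Notation nr := (nroots D).
Local Notation T := (ads D).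
Hypothesis ok : tables_ok D T.

Definition hom (d : nat -> int) (k : int) (M : 'M[int]_n) : Prop :=
  forall r c : 'I_n, M r c != 0 -> d r = d c + k.

Lemma mulmx_neq0 (S : pzSemiRingType) p q s (A : 'M[S]_(p, q)) (B : 'M[S]_(q, s)) i j :
  (A *m B) i j != 0 -> exists k, A i k != 0 /\ B k j != 0.
Proof.
rewrite mxE; case: (pickP (fun k => (A i k != 0) && (B k j != 0))) => [k /andP[] ? ? _|H].
  by exists k.
rewrite big1 ?eqxx // => k _; move: (H k); case: eqP => [->|_ /=]; first by rewrite mul0r.
by move/negbFE/eqP->; rewrite mulr0.
Qed.

Lemma homs_hom d k a : homs D d k (nth [::] T a) -> hom d k (adk D a).
Proof.
move/allnP => H r c; rewrite mxE => /scoef_mem[p pc <-].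
by move/allP/(_ p pc)/eqP: (H c (ltn_ord c)).
Qed.

Lemma hom_iter d k (A : 'M[int]_n) m : hom d k A -> hom d (k *+ m) (iter m (mulmx A) 1%:M).
Proof.
move=> hA; elim: m => [|m IH] r c /=.
  by rewrite mxE; case: (r =P c) => [->|]; rewrite ?addr0.
by case/mulmx_neq0 => l [/hA-> /IH->]; rewrite mulrS addrAC -addrA addrC.
Qed.

Lemma adpowZ_neq0 a m r c : adpowZ D a m r c != 0 -> iter m (mulmx (adZ D a)) 1%:M r c != 0.
Proof. by apply: contra => /eqP z; rewrite mxE z div0z. Qed.

Lemma hom_adpow d k a m : (a < nr)%N -> hom d k (adk D a) -> hom d (k *+ m) (adpowZ D a m).
Proof.
by move=> lta hA r c /adpowZ_neq0; apply: hom_iter; rewrite adZ_smx.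
Qed.

Variable F : fieldType.

Definition dmx (d : nat -> int) (t : F) : 'M[F]_n := diag_mx (\row_r t ^ d r).

Lemma dmx_xroot d k a (t s : F) : (a < nr)%N -> hom d k (adk D a) -> t != 0 ->
  dmx d t *m xroot D a s = xroot D a (t ^ k * s) *m dmx d t.
Proof.
move=> lta hA t0; rewrite mul_diag_mx mul_mx_diag; apply/matrixP => r c; rewrite !mxE !summxE.
rewrite mulr_sumr mulr_suml; apply: eq_bigr => m _.
have dpE x : (x *: dp D F a m) r c = x * (adpowZ D a m r c)%:~R by rewrite mxE [dp _ _ _ _ _ _]mxE.
rewrite !dpE; have [->|ne] := eqVneq (adpowZ D a m r c) 0; first by rewrite !mulr0 mul0r.
rewrite (hom_adpow lta hA ne) expfzDr // exprMn.
have -> : t ^ (k *+ m) = (t ^ k) ^+ m by rewrite -mulr_natr natz -exprz_exp.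
by rewrite [RHS]mulrC !mulrA.
Qed.

Lemma dmxV d (t : F) : t != 0 -> dmx d t *m dmx d t^-1 = 1%:M.
Proof.
move=> t0; rewrite mulmx_diag -[RHS]diag_const_mx; congr diag_mx; apply/rowP => j.
by rewrite !mxE exprz_inv -expfzDr // subrr.
Qed.
End Torus.

(** * The Chevalley group *)

Section Inverses.
Variables (F : fieldType) (m : nat).
Implicit Types A B : 'M[F]_m.

Lemma mulmx1_invmx A B : A *m B = 1%:M -> A \in unitmx /\ invmx A = B.
Proof.
move=> AB; have [uA _] := mulmx1_unit AB; split=> //.
by rewrite -[RHS]mul1mx -(mulVmx uA) -mulmxA AB mulmx1.
Qed.

Lemma invmxM A B : A \in unitmx -> B \in unitmx -> invmx (A *m B) = invmx B *m invmx A.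
Proof.
move=> uA uB; apply: (proj2 (mulmx1_invmx _)).
by rewrite -mulmxA (mulmxA B) mulmxV // mul1mx mulmxV.
Qed.
End Inverses.

Section Gen.
Variables (F : fieldType) (D : rootdata).
Implicit Types X Y : 'M[F]_(ldim D) -> Prop.

Lemma gen_incl X x : X x -> gen X x.
Proof. by move=> Xx; rewrite -[x]mulmx1; apply: genM => //; apply: gen1. Qed.

Lemma gen_mul X x y : gen X x -> gen X y -> gen X (x *m y).
Proof.
move=> gx gy; elim: gx => [|u v Xu _ IH|u v Xu _ IH]; first by rewrite mul1mx.
  by rewrite -mulmxA; apply: genM.
by rewrite -mulmxA; apply: genV.
Qed.

Lemma gen_sub X Y x : (forall u, X u -> Y u) -> gen X x -> gen Y x.
Proof.
move=> XY; elim=> [|u v Xu _ IH|u v Xu _ IH]; first exact: gen1.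
  by apply: genM => //; apply: XY.
by apply: genV => //; apply: XY.
Qed.

Lemma gen_inv X x : (forall u, X u -> u \in unitmx) -> gen X x ->
  x \in unitmx /\ gen X (invmx x).
Proof.
move=> uX; elim=> [|u v Xu _ [uv IH]|u v Xu _ [uv IH]].
- by rewrite unitmx1 invmx1; split=> //; apply: gen1.
- have uu := uX u Xu; rewrite unitmx_mul uu uv invmxM //; split=> //.
  by apply: gen_mul IH _; rewrite -[invmx u]mulmx1; apply: genV => //; apply: gen1.
have uu := uX u Xu; rewrite unitmx_mul unitmx_inv uu uv invmxM ?unitmx_inv // invmxK.
by split=> //; apply: gen_mul IH _; apply: gen_incl.
Qed.
End Gen.

Section Group.
Variable D : rootdata.
Local Notation n := (ldim D).
Local Notation nr := (nroots D).
Local Notation T := (ads D).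
Hypothesis ok : tables_ok D T.
Variables (i0 a0 : nat).
Hypothesis tok : torus_ok D T i0 a0.
Variable F : fieldType.
Local Notation xr := (@xr F D).
Local Notation wr := (@wr F D).
Local Notation hr := (@hr F D).
Local Notation chev := (@chev F D).
Local Notation parab := (@parab F D).
Local Notation borel := (@borel F D).

Lemma xr_inv a t : (a < nr)%N -> xr a t \in unitmx /\ invmx (xr a t) = xr a (- t).
Proof. by move=> lta; apply/mulmx1_invmx/(xrootVK ok). Qed.

Lemma gw_inv (w : seq (nat * F)) : roots_in D w ->
  gw D w \in unitmx /\ invmx (gw D w) = gw D (winv w).
Proof. by move=> win; apply/mulmx1_invmx/(gw_winvr ok). Qed.

Lemma chev_gw (w : seq (nat * F)) : roots_in D w -> chev (gw D w).
Proof.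
elim: w => [|l w IH] /=; first by move=> _; apply: gen1.
by case/andP=> ltl /IH cw; apply: genM => //; exists l.1; split=> //; exists l.2.
Qed.

Lemma chev_word g : chev g -> exists2 w : seq (nat * F), roots_in D w & g = gw D w.
Proof.
elim=> [|x y [a [lta [t ->]]] _ [w win ->]|x y [a [lta [t ->]]] _ [w win ->]].
- by exists [::].
- by exists ((a, t) :: w); rewrite //= lta.
by exists ((a, - t) :: w); rewrite /= ?lta // (proj2 (xr_inv t lta)).
Qed.

Lemma chev_inv g : chev g -> g \in unitmx /\ chev (invmx g).
Proof.
case/chev_word => w win ->; have [u ->] := gw_inv win; split=> //.
by apply: chev_gw; rewrite roots_winv.
Qed.

Lemma chev_mul g h : chev g -> chev h -> chev (g *m h).
Proof. exact: gen_mul. Qed.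

Lemma simple_root i : (i < rk D)%N -> (simple D i < nr)%N /\ (neg D (simple D i) < nr)%N.
Proof. by move=> lti; case/andP: tok => /allnP/(_ i lti)/and5P[]. Qed.

Lemma wr_gw a : wr a 1 = gw D (wcast F (wrword D 1 a)).
Proof. by rewrite /Defs.wr invr1 /= mulmx1 mulmxA. Qed.

Lemma wrword_roots c i : (i < rk D)%N -> roots_in D (wrword D c (simple D i)).
Proof. by case/simple_root => s1 s2; rewrite /roots_in /= s1 s2. Qed.

(** Conjugating w_i(1) by the torus of the alpha_i-grading gives w_i(t). This multiplies the entry
    (r, c) by t to the power [dcoef i r] - [dcoef i c], which is [dpair i r] wherever the entry is
    nonzero. *)
Lemma wr_dmx i (t : F) : (i < rk D)%N -> t != 0 ->
  wr (simple D i) t = dmx D (dpair D i) t *m wr (simple D i) 1.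
Proof.
move=> lti t0; set s := simple D i; have [s1 s2] := simple_root lti.
case/andP: (tok) => /allnP/(_ i lti)/and5P[_ _ /homs_hom h1 /homs_hom h2 /allnP h3] _.
have E : dmx D (dcoef D i) t *m wr s 1 = wr s t *m dmx D (dcoef D i) t.
  rewrite /Defs.wr !mulmxA (dmx_xroot 1 s1 h1) // expr1z mulr1.
  rewrite -(mulmxA (xroot D s t)) (dmx_xroot _ s2 h2) // exprN1 mulrN invr1 mulr1.
  by rewrite -!mulmxA (dmx_xroot 1 s1 h1) // expr1z mulr1.
apply/matrixP => r c; move/matrixP/(_ r c): E.
have rowE (d : nat -> int) k : (\row_(r < n) t ^ d r) 0 k = t ^ d k by rewrite mxE.
rewrite mul_diag_mx mul_mx_diag [LHS]mxE [RHS]mxE !rowE => E.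
rewrite mul_diag_mx [RHS]mxE rowE.
have tc0 : t ^ dcoef D i c != 0 by rewrite expfz_neq0.
apply: (mulIf tc0); rewrite -E wr_gw -smx_wmat ?wrword_roots // mxE [smx _ _ _ _]mxE.
have [->|ne] := eqVneq (scoef (scol (wmat D T (wrword D 1 s)) c) r) 0.
  by rewrite !mulr0 mul0r.
have [p pc pr] := scoef_mem ne; move/allP/(_ p pc)/eqP: (h3 c (ltn_ord c)).
by rewrite pr => ->; rewrite expfzDr // -mulrA [LHS]mulrC.
Qed.

Lemma hr_dmx i (t : F) : (i < rk D)%N -> t != 0 -> hr (simple D i) t = dmx D (dpair D i) t.
Proof.
move=> lti t0; rewrite /Defs.hr wr_dmx // -mulmxA mulmxV ?mulmx1 //.
by rewrite wr_gw; apply: (proj1 (gw_inv _)); rewrite roots_wcast wrword_roots.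
Qed.

Lemma chev_wr i (t : F) : (i < rk D)%N -> chev (wr (simple D i) t).
Proof.
case/simple_root => s1 s2.
pose w := [:: (simple D i, t); (neg D (simple D i), - t^-1); (simple D i, t)].
have -> : wr (simple D i) t = gw D w by rewrite /w /= mulmx1 mulmxA.
by apply: chev_gw; rewrite /roots_in /= s1 s2.
Qed.

Lemma chev_hr i (t : F) : (i < rk D)%N -> chev (hr (simple D i) t).
Proof. by move=> lti; apply: chev_mul; [|apply: (proj2 (chev_inv _))]; apply: chev_wr. Qed.

Definition pgen (J : {set 'I_(rk D)}) (g : 'M[F]_n) : Prop :=
  borel_gen g \/ exists k : 'I_(rk D), k \in ~: J /\ rootsub (neg D (simple D k)) g.

Lemma pgen_chev J g : pgen J g -> chev g.
Proof.
have xc a t : (a < nr)%N -> chev (xr a t) by move=> lta; apply: gen_incl; exists a; split=> //; exists t.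
case=> [[[a [[lta _] [t ->]]]|[i [t [t0 ->]]]]|[k [_ [t ->]]]]; first exact: xc.
  exact: chev_hr.
by apply: xc; case: (simple_root (ltn_ord k)).
Qed.

Lemma parab_inv J p : parab (~: J) p -> p \in unitmx /\ parab (~: J) (invmx p).
Proof. by apply: gen_inv => u /(@pgen_chev J)/chev_inv[]. Qed.

Lemma borel_parab J b : borel b -> parab (~: J) b.
Proof. by apply: gen_sub => u Bu; left. Qed.

(** Reduces opposite simplices of type J to opposite vertices of each type in J. *)
Lemma parabS (i : 'I_(rk D)) (J : {set 'I_(rk D)}) p : i \in J ->
  parab (~: J) p -> parab (~: [set i]) p.
Proof.
move=> iJ; apply: gen_sub => u [Bu|[k [kJ Uk]]]; first by left.
by right; exists k; split=> //; rewrite inE; apply: contraL kJ; rewrite !inE negbK => /eqP->.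
Qed.

Lemma Type_of_conj (x th th' : 'M[F]_n) i : chev x -> x *m th = th' *m x ->
  Type_of th i -> Type_of th' i.
Proof.
move=> cx E [J [g [iJ [cg [p [q [pp [pq [b1 [b2 [B1 [B2 H]]]]]]]]]]]].
have [ux _] := chev_inv cx; have [ug _] := chev_inv cg; have [up _] := parab_inv pp.
exists J, (x *m g); split=> //; split; first exact: chev_mul.
exists p, q; do 2!split=> //; exists b1, b2; do 2!split=> //; rewrite -H.
rewrite -mulmxA invmxM ?unitmx_mul ?ug // -!mulmxA; congr (_ *m _).
by rewrite (mulmxA th') -E -!mulmxA mulKmx.
Qed.

Lemma Type_of_intro (th g p q : 'M[F]_n) (i : 'I_(rk D)) : chev g ->
  parab (~: [set i]) p -> parab (~: [set i]) q ->
  th *m g = g *m (p *m n0 F D *m q) -> Type_of th i.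
Proof.
move=> cg pp pq E; have [ug _] := chev_inv cg; have [up _] := parab_inv pp.
have [uq pqV] := parab_inv pq.
exists [set i], g; split; first by rewrite inE.
split=> //; exists p, (invmx q); do 2!split=> //; exists 1%:M, 1%:M; do 2!(split; first exact: gen1).
by rewrite invmxM // E mul1mx mulmx1 -!mulmxA mulKmx // mulKmx // mulmxV // mulmx1.
Qed.

(** The Borel factors in the definition of opposite chambers are absorbed into the maximal parabolic
    subgroup. *)
Lemma Type_of_elim (th : 'M[F]_n) (i : 'I_(rk D)) : Type_of th i ->
  exists g p q, [/\ chev g, parab (~: [set i]) p, parab (~: [set i]) q &
    invmx g *m th *m g = p *m n0 F D *m q].
Proof.
case=> J [g [iJ [cg [p [q [pp [pq [b1 [b2 [B1 [B2 H]]]]]]]]]]].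
have [ug _] := chev_inv cg; have [up _] := parab_inv pp; have [uq pqV] := parab_inv pq.
exists g, (p *m b1), (b2 *m invmx q); split=> //.
- by apply: (parabS iJ); apply: gen_mul => //; apply: borel_parab.
- by apply: (parabS iJ); apply: gen_mul => //; apply: borel_parab.
have -> : p *m b1 *m n0 F D *m (b2 *m invmx q) = p *m (b1 *m n0 F D *m b2) *m invmx q.
  by rewrite !mulmxA.
by rewrite -H invmxM // -!mulmxA mulKVmx // mulmxV // mulmx1.
Qed.

Hypothesis sok : short_ok D T a0.
Hypotheses (a0r : (a0 < nr)%N) (i0r : (i0 < rk D)%N).

Lemma a0_conj (t : F) : t != 0 -> exists2 x, chev x & x *m xr a0 t = xr a0 1 *m x.
Proof.
(* ad e_{a0} has degree -1 for the coroot of alpha_{i0}, so the parameter t becomes t^-1 t = 1. *)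
move=> t0; exists (hr (simple D i0) t); first exact: chev_hr.
case/andP: tok => _ /homs_hom h; rewrite hr_dmx // (dmx_xroot _ a0r h) //.
by rewrite exprN1 mulVf.
Qed.

Lemma step_conj j b (t : F) : (j < rk D)%N -> (b < nr)%N -> t != 0 ->
  (step (wrtab D T) j b < nr)%N /\ exists2 s, s != 0 &
  wr (simple D j) 1 *m xr b t = xr (step (wrtab D T) j b) s *m wr (simple D j) 1.
Proof.
move=> ltj ltb t0; case/andP: sok => /allnP/(_ j ltj)/allnP/(_ b ltb)/andP[lts H] _.
split=> //; set b' := step _ _ _ in lts H *.
have tabE : nth [::] (wrtab D T) j = wmat D T (wrword D 1 (simple D j)).
  by rewrite (nth_map 0%N) ?size_iota // nth_iota.
rewrite tabE in H.
have C c := @conj_xroot D ok F (wrword D 1 (simple D j)) b b' c t (wrword_roots _ ltj) ltb lts.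
rewrite wr_gw; case/orP: H => /eqP /C E; [exists (1%:~R * t) | exists ((-1)%:~R * t)] => //.
  by rewrite mul1r.
by rewrite mulN1r oppr_eq0.
Qed.

Lemma lowest_conj fuel b : (b < nr)%N -> lowest D (wrtab D T) fuel b = a0 ->
  forall t : F, t != 0 -> exists2 x, chev x & x *m xr b t = xr a0 1 *m x.
Proof.
elim: fuel b => [|f IH] b ltb /=; first by move=> -> t; apply: a0_conj.
case E: [seq _ <- _ | _] => [|c s]; first by move=> -> t; apply: a0_conj.
have : c \in [seq step (wrtab D T) j b | j <- iota 0 (rk D)].
  by move: (mem_head c s); rewrite -E mem_filter => /andP[].
case/mapP => j; rewrite mem_iota add0n => ltj -> low t t0.
have [lts [u u0 Eu]] := step_conj ltj ltb t0.
have [x cx Ex] := IH _ lts low u u0.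
exists (x *m wr (simple D j) 1); first by apply: chev_mul => //; apply: chev_wr.
by rewrite -mulmxA Eu mulmxA Ex -mulmxA.
Qed.

Lemma short_conj a (t : F) : short D a -> t != 0 ->
  exists2 x, chev x & x *m xr a t = xr a0 1 *m x.
Proof.
case=> lta [b [ltb]]; rewrite /rnorm !bilE => lt t0.
case/andP: sok => _ /allnP/(_ a lta)/implyP H.
apply: (lowest_conj lta _ t0); apply/eqP/H/hasP; exists b => //.
by rewrite mem_iota.
Qed.

Lemma Type_of_short a (th : 'M[F]_n) i : short D a -> rootsub a th -> th != 1%:M ->
  Type_of th i <-> Type_of (xr a0 1) i.
Proof.
move=> sa [t ->] ne; have t0 : t != 0.
  by apply: contraNneq ne => ->; apply/eqP/(xroot0 ok).
have [x cx E] := short_conj sa t0; have [ux cxV] := chev_inv cx.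
split; first exact: Type_of_conj E.
apply: (Type_of_conj cxV); apply: (can_inj (mulKmx ux)).
by rewrite mulKVmx // mulmxA E mulmxK.
Qed.
End Group.

(** * Words in parabolic subgroups *)

Section ParabolicChecks.
Variables (D : rootdata) (T : seq smat).
Let n := ldim D.
Let nr := nroots D.

Definition posb a : bool := all (fun i => 0 <= rcoef D a i) (iota 0 (rk D)).
Definition allowed i a : bool :=
  (a < nr)%N && (posb a || has (fun k => (k != i) && (a == neg D (simple D k))) (iota 0 (rk D))).
Definition n0word : seq (nat * int) := flatten [seq wrword D 1 (simple D i) | i <- w0word D].
(** w_k(1)^-1 = w_k(-1), so this word is the torus element h_k(-1). *)
Definition hword k : seq (nat * int) :=
  wrword D (-1) (simple D k) ++ wrword D (-1) (simple D k).
Definition pblock i (b : seq (nat * int)) : bool :=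
  all (fun l => allowed i l.1) b || has (fun k => b == hword k) (iota 0 (rk D)).
Definition cell_ok i (u : seq (nat * int)) (ps qs : seq (seq (nat * int))) : bool :=
  [&& roots_in D u, all (pblock i) ps, all (pblock i) qs &
      wmat D T u == wmat D T (flatten ps ++ n0word ++ flatten qs)].
(** The relation x_a(1) x_b(s) = x_b(s) x_d(cs) x_a(1), coefficient by coefficient in s; all degrees
    are below 8. *)
Definition comm_ok a b d c : bool :=
  let X := wmat D T [:: (a, 1)] in
  let Eb := dpow D (nth [::] T b) in let Ed := dpow D (nth [::] T d) in
  [&& shortb D a, (a < nr)%N, (b < nr)%N, (d < nr)%N &
  all (fun k => all (fun j => nform (sapp X (scol (nth [::] Eb k) j)) ==
     nform (flatten [seq sscale (zexp c (k - i))
         (sapp (nth [::] Eb i) (sapp (nth [::] Ed (k - i)) (scol X j))) | i <- iota 0 k.+1]))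
    (iota 0 n)) (iota 0 8)].

Definition spres (Q : pred nat) (M : smat) : bool :=
  all (fun c => Q c ==> all (fun p => Q p.1) (scol M c)) (iota 0 n).
(** The generators of P preserve V, spanned by [tops], and the coordinate complement of V-, spanned
    by [negs]; n0 maps V into V-. *)
Definition parab_ok i (tops negs : seq nat) : bool :=
  all (fun a => allowed i a ==>
     spres (fun c => c \in tops) (nth [::] T a) && spres (fun c => c \notin negs) (nth [::] T a))
    (iota 0 nr)
  && let M := wmat D T n0word in
     all (fun c => all (fun p => p.1 \in negs) (scol M c)) tops.
Definition block_ok (K : smat) a0 i (tops : seq nat) : bool :=
  [&& parab_ok i tops [seq neg D a | a <- tops], core_ok D T K a0 tops,
      all (fun a => a < nr)%N tops & all (fun al => scol K al == [:: (neg D al, 1)]) tops].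
End ParabolicChecks.

Section Parabolic.
Variable D : rootdata.
Local Notation n := (ldim D).
Local Notation nr := (nroots D).
Local Notation T := (ads D).
Hypothesis ok : tables_ok D T.
Variables (i0 a0 : nat).
Hypothesis tok : torus_ok D T i0 a0.
Hypothesis w0r : all (fun i => i < rk D)%N (w0word D).
Variable F : fieldType.
Local Notation xr := (@xr F D).
Local Notation wr := (@wr F D).
Local Notation hr := (@hr F D).
Local Notation chev := (@chev F D).
Local Notation parab := (@parab F D).

Lemma wcast_cat u v : wcast F (u ++ v) = wcast F u ++ wcast F v.
Proof. exact: map_cat. Qed.

Lemma n0_gw : n0 F D = gw D (wcast F (n0word D)).
Proof.
rewrite /n0 /n0word; elim: (w0word D) => // i s IH.
have -> j : flatten [seq wrword D 1 (simple D k) | k <- j :: s] =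
  wrword D 1 (simple D j) ++ flatten [seq wrword D 1 (simple D k) | k <- s] by [].
by rewrite wcast_cat gw_cat -wr_gw -IH.
Qed.

Lemma n0word_roots : roots_in D (n0word D).
Proof.
rewrite /n0word /roots_in; elim: (w0word D) w0r => //= i s IH /andP[lti /IH ->].
by case: (simple_root tok lti) => -> ->.
Qed.

Lemma gw_hword k : (k < rk D)%N -> gw D (wcast F (hword D k)) = hr (simple D k) (-1).
Proof.
move=> ltk; have [s1 s2] := simple_root tok ltk.
rewrite wcast_cat gw_cat /Defs.hr; congr (_ *m _).
  by rewrite /Defs.wr invrN1 opprK /= mulmx1 mulmxA.
rewrite wr_gw (proj2 (gw_inv ok _)) ?roots_wcast ?(wrword_roots tok) //.
by rewrite /winv /= !rmorphN !opprK.
Qed.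

Lemma allowed_parab (i : 'I_(rk D)) a t : allowed D i a -> parab (~: [set i]) (xr a t).
Proof.
case/andP=> lta /orP[pa|/hasP[k]].
  apply: gen_incl; left; left; exists a; split; last by exists t.
  by split=> // j ltj; move/allnP: pa; apply.
rewrite mem_iota => ltk /andP[ne /eqP ->]; apply: gen_incl; right; exists (Ordinal ltk).
by split; [rewrite !inE -val_eqE|exists t].
Qed.

Lemma pblock_parab (i : 'I_(rk D)) b : pblock D i b ->
  roots_in D b /\ parab (~: [set i]) (gw D (wcast F b)).
Proof.
case/orP=> [H|/hasP[k]].
  elim: b H => [|l b IH] /=; first by split=> //; apply: gen1.
  case/andP=> al /IH[bin pb]; split; first by case/andP: al => ->.
  by apply: gen_mul => //; apply: allowed_parab.
rewrite mem_iota => ltk /eqP ->; split.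
  by rewrite /roots_in all_cat; apply/andP; split; apply: (wrword_roots tok).
rewrite gw_hword //; apply: gen_incl; left; right; exists (Ordinal ltk), (-1).
by rewrite oppr_eq0 oner_eq0.
Qed.

Lemma pblocks_parab (i : 'I_(rk D)) bs : all (pblock D i) bs ->
  roots_in D (flatten bs) /\ parab (~: [set i]) (gw D (wcast F (flatten bs))).
Proof.
elim: bs => [|b bs IH] /=; first by split=> //; apply: gen1.
case/andP=> /pblock_parab[r1 p1] /IH[r2 p2]; rewrite wcast_cat gw_cat; split.
  by rewrite /roots_in all_cat; apply/andP.
exact: gen_mul.
Qed.

Lemma cell_parab (i : 'I_(rk D)) u ps qs : cell_ok D T i u ps qs ->
  exists p q, [/\ parab (~: [set i]) p, parab (~: [set i]) q &
    gw D (wcast F u) = p *m n0 F D *m q].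
Proof.
case/and4P=> uin /pblocks_parab[r1 p1] /pblocks_parab[r2 p2] E.
exists (gw D (wcast F (flatten ps))), (gw D (wcast F (flatten qs))); split=> //.
rewrite n0_gw -mulmxA -!gw_cat -!wcast_cat; apply: (wmat_eq ok) => //.
by rewrite /roots_in !all_cat; apply/and3P; split=> //; apply: n0word_roots.
Qed.

Lemma Type_of_cell (i : 'I_(rk D)) a ps qs :
  cell_ok D T i [:: (a, 1)] ps qs -> Type_of (xr a 1) i.
Proof.
case/cell_parab => p [q [pp pq E]]; apply: (Type_of_intro ok tok (gen1 _) pp pq).
by rewrite mulmx1 mul1mx -E /= mulmx1.
Qed.

Lemma size_dpow M k : size M = n -> (size (nth [::] (dpow D M) k) <= n)%N.
Proof.
move=> sM; case: k => [|[|[|[|k]]]] /=; rewrite ?size_mkseq ?sM ?size_map ?size_smul ?sM //.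
by rewrite nth_nil.
Qed.

Lemma comm_xroot a b d c (s : F) : comm_ok D T a b d c ->
  xr a 1 *m xr b s = xr b s *m (xr d (c%:~R * s) *m xr a 1).
Proof.
case/and5P=> _ lta ltb ltd H.
have sz e k : (e < nr)%N -> (size (nth [::] (dpow D (nth [::] T e)) k) <= n)%N.
  by move=> lte; apply/size_dpow/(size_ads ok)/ltn_ldim.
set X := wmat D T [:: (a, 1)] in H.
have sX : size X = n by apply: size_wmat.
have XE : toR F (smx n X) = xr a 1 by rewrite (smx_wmat ok) /roots_in /= ?lta // mulmx1.
have E k : (k < 8)%N -> smx n X *m adpowZ D b k =
    \sum_(i < k.+1) c ^+ (k - i) *: (adpowZ D b i *m (adpowZ D d (k - i) *m smx n X)).
  move=> ltk; apply/matrixP => r j.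
  move/allnP/(_ k ltk)/allnP/(_ j (ltn_ord j))/eqP/(scoef_nform_eq r): H.
  rewrite (scoef_sapp _ _ sX) scoef_flatten big_map summxE mxE.
  rewrite -/(index_iota 0 k.+1) big_mkord => H.
  rewrite (proj1 (adpowZ_dpow ok k ltb)).
  under [LHS]eq_bigr => l _ do rewrite !mxE.
  rewrite H; apply: eq_bigr => i _; rewrite scoef_scale zexpE [RHS]mxE; congr (_ * _).
  rewrite (scoef_sapp_le _ _ (sz _ _ ltb)) mxE; apply: eq_bigr => l _.
  rewrite (proj1 (adpowZ_dpow ok i ltb)) mxE; congr (_ * _).
  rewrite (scoef_sapp_le _ _ (sz _ _ ltd)) mxE; apply: eq_bigr => m _.
  by rewrite (proj1 (adpowZ_dpow ok (k - i) ltd)) !mxE.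
have EF k : (k < 8)%N -> xr a 1 *m dp D F b k =
    \sum_(i < k.+1) c%:~R ^+ (k - i) *: (dp D F b i *m dp D F d (k - i)) *m xr a 1.
  move=> ltk; rewrite -XE /dp -toRM E // toR_sum; apply: eq_bigr => i _.
  by rewrite toRZ !toRM mulmxA scalemxAl rmorphXn.
rewrite mulmxA -[X in X *m xr b s]/(xr a 1) [xr b s](@xroot_sum _ ok _ 8) // mulmx_sumr.
rewrite -[in RHS](@xroot_sum _ ok _ 8) // [xroot D b s](@xroot_sum _ ok _ 4) //.
rewrite -[xr d _]/(xroot D d _) [xroot D d _](@xroot_sum _ ok _ 4) //.
rewrite exp_conv; try by move=> k; apply: dp_ge4.
rewrite mulmx_suml; apply: eq_bigr => k _; rewrite -scalemxAr EF // mulmx_suml scaler_sumr.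
apply: eq_bigr => i _; rewrite -!scalemxAl scalerA exprMn.
have lek : (i <= k)%N by rewrite -ltnS.
by rewrite -{1}(subnKC lek) exprD -mulrA [s ^+ (k - i) * _]mulrC.
Qed.

Hypothesis sok : short_ok D T a0.
Hypotheses (a0r : (a0 < nr)%N) (i0r : (i0 < rk D)%N).

(** The short element x_a(1) is conjugate both to x_{a0}(1) and, by x_b(s), to x_d(cs) x_a(1), for
    which the cell is known when cs = 1. *)
Lemma Type_of_comm (i : 'I_(rk D)) a b d c ps qs : comm_ok D T a b d c ->
  cell_ok D T i [:: (d, 1); (a, 1)] ps qs -> c%:~R != 0 :> F -> Type_of (xr a0 1) i.
Proof.
move=> com /cell_parab[p [q [pp pq E]]] c0.
have [sa lta ltb _ _] := and5P com.
have sha : short D a.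
  split=> //; case/hasP: sa => b'; rewrite mem_iota => ltb' lt.
  by exists b'; split=> //; rewrite /rnorm !bilE.
have [x cx Ex] := short_conj ok tok sok a0r i0r sha (oner_neq0 F).
apply: (Type_of_conj ok tok cx Ex).
(* The choice s = 1/c makes the long root parameter cs equal to 1. *)
have cb : chev (xr b c%:~R^-1) by apply: gen_incl; exists b; split=> //; exists c%:~R^-1.
apply: (Type_of_intro ok tok cb pp pq).
by rewrite (comm_xroot _ com) mulfV // -E /= mulmx1.
Qed.
End Parabolic.

(** * Opposite vertices *)

Section Support.
Variables (F : fieldType) (n : nat).
Implicit Types (Q : pred nat) (M : 'M[F]_n) (z : 'cV[F]_n).

Definition supp Q z : Prop := forall r : 'I_n, z r 0 != 0 -> Q r.
Definition pres Q M : Prop := forall r c : 'I_n, Q c -> M r c != 0 -> Q r.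
Definition stab Q M : Prop := [/\ M \in unitmx, pres Q M & pres Q (invmx M)].

Lemma pres_supp Q M z : pres Q M -> supp Q z -> supp Q (M *m z).
Proof. by move=> QM Qz r /mulmx_neq0[k [Mrk /Qz Qk]]; apply: QM Mrk. Qed.

Lemma presM Q M N : pres Q M -> pres Q N -> pres Q (M *m N).
Proof. by move=> QM QN r c Qc /mulmx_neq0[k [Mrk /(QN _ _ Qc) Qk]]; apply: QM Mrk. Qed.

Lemma pres_diag Q (d : 'rV[F]_n) : pres Q (diag_mx d).
Proof.
by move=> r c Qc; rewrite mxE; case: (r =P c) => [->|]; rewrite ?mulr0n ?eqxx.
Qed.

Lemma stab1 Q : stab Q 1%:M.
Proof.
rewrite /stab unitmx1 invmx1 -diag_const_mx; split=> //; exact: pres_diag.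
Qed.

Lemma stabM Q M N : stab Q M -> stab Q N -> stab Q (M *m N).
Proof.
case=> uM M1 M2 [uN N1 N2]; split; first by rewrite unitmx_mul uM.
  exact: presM.
by rewrite invmxM //; apply: presM.
Qed.

Lemma stabV Q M : stab Q M -> stab Q (invmx M).
Proof. by case=> uM M1 M2; split; rewrite ?unitmx_inv ?invmxK. Qed.
End Support.

(** * The block from V to V- for elements of P n0 P *)

Section Opposite.
Variable D : rootdata.
Local Notation n := (ldim D).
Local Notation nr := (nroots D).
Local Notation T := (ads D).
Hypothesis ok : tables_ok D T.
Variables (i0 a0 : nat).
Hypothesis tok : torus_ok D T i0 a0.
Hypothesis w0r : all (fun i => i < rk D)%N (w0word D).
Variable F : fieldType.
Local Notation xr := (@xr F D).

Lemma spres_xroot Q a (t : F) : (a < nr)%N -> spres D Q (nth [::] T a) -> pres Q (xroot D a t).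
Proof.
move=> lta /allnP H.
have adQ (r c : 'I_n) : Q c -> adZ D a r c != 0 -> Q r.
  move=> Qc; rewrite adZ_smx // mxE => /scoef_mem[p pc <-].
  by move: (H c (ltn_ord c)); rewrite Qc => /allP/(_ p pc).
have itQ m (r c : 'I_n) : Q c -> iter m (mulmx (adZ D a)) 1%:M r c != 0 -> Q r.
  elim: m r => [|m IH] r Qc /=; first by rewrite mxE; case: (r =P c) => [->|].
  by case/mulmx_neq0 => l [rl /(IH _ Qc) Ql]; apply: adQ rl.
move=> r c Qc; case: (pickP (fun m : 'I_n => adpowZ D a m r c != 0)) => [m|H0].
  by move/adpowZ_neq0/itQ => E _; apply: E.
rewrite summxE big1 ?eqxx // => m _.
by rewrite mxE [dp _ _ _ _ _ _]mxE (eqP (negbFE (H0 m))) mulr0.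
Qed.

Variables (Ks : smat) (i : 'I_(rk D)) (tops : seq nat).
Hypothesis fok : form_ok D T Ks.
Hypothesis a0r : (a0 < nr)%N.
Hypothesis bok : block_ok D T Ks a0 i tops.
Let negs := [seq neg D a | a <- tops].
Let pok : parab_ok D T i tops negs. Proof. by case/and4P: bok. Qed.
Let cok : core_ok D T Ks a0 tops. Proof. by case/and4P: bok. Qed.
Let topsr : all (fun a => a < nr)%N tops. Proof. by case/and4P: bok. Qed.
Let Kneg : all (fun al => scol Ks al == [:: (neg D al, 1)]) tops. Proof. by case/and4P: bok. Qed.
Let Q1 : pred nat := fun c => c \in tops.
Let Q2 : pred nat := fun c => c \notin negs.

Lemma allowed_stab a (t : F) : allowed D i a -> stab Q1 (xr a t) /\ stab Q2 (xr a t).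
Proof.
move=> al; have lta : (a < nr)%N by case/andP: al.
case/andP: pok => /allnP/(_ a lta); rewrite al => /andP[h1 h2] _.
have [u uV] := xr_inv ok t lta.
by split; split; rewrite // ?uV; apply: spres_xroot.
Qed.

Lemma parab_stab (p : 'M[F]_n) : parab (~: [set i]) p -> stab Q1 p /\ stab Q2 p.
Proof.
have H u : pgen [set i] u -> stab Q1 (u : 'M[F]_n) /\ stab Q2 (u : 'M[F]_n).
  case=> [[[a [[lta pa] [t ->]]]|[k [t [t0 ->]]]]|[k [kJ [t ->]]]].
  - by apply: allowed_stab; rewrite /allowed; apply/andP; split=> //; apply/orP; left; apply/allnP.
  - rewrite (hr_dmx ok tok) //.
    have [u1 u2] := mulmx1_invmx (dmxV D (dpair D k) t0).
    by split; split; rewrite // ?u2; apply: pres_diag.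
  apply: allowed_stab; rewrite /allowed; have [_ ->] := simple_root tok (ltn_ord k).
  apply/orP; right; apply/hasP; exists (val k); first by rewrite mem_iota /= ltn_ord.
  by rewrite eqxx andbT val_eqE; move: kJ; rewrite !inE.
elim=> [|u v Xu _ [IH1 IH2]|u v Xu _ [IH1 IH2]]; first by split; apply: stab1.
  by have [h1 h2] := H u Xu; split; apply: stabM.
by have [h1 h2] := H u Xu; split; apply: stabM => //; apply: stabV.
Qed.

Lemma n0_supp (z : 'cV[F]_n) : supp Q1 z -> supp (fun c => c \in negs) (n0 F D *m z).
Proof.
move=> Qz r /mulmx_neq0[k [nrk /Qz Qk]]; move: nrk.
rewrite n0_gw -(smx_wmat ok) ?(n0word_roots tok) // mxE [smx _ _ _ _]mxE => ne.
have : scoef (scol (wmat D T (n0word D)) k) r != 0 by apply: contraNneq ne => ->.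
case/scoef_mem => q qc <-; case/andP: pok => _ /allP/(_ _ Qk)/allP.
by apply.
Qed.

(** q z lies in V, so n0 q z lies in V-; applying p^-1 to the hypothesis puts it in the complement
    of V- as well, so it is zero. *)
Lemma opposite_block (p q : 'M[F]_n) (z : 'cV[F]_n) :
  parab (~: [set i]) p -> parab (~: [set i]) q -> supp Q1 z ->
  supp Q2 (p *m n0 F D *m q *m z) -> z = 0.
Proof.
move=> /parab_stab[_ [up _ p2]] /parab_stab[[uq q1 _] _] Qz Qy.
have un : n0 F D \in unitmx.
  by rewrite n0_gw; apply: (proj1 (gw_inv ok _)); rewrite roots_wcast (n0word_roots tok).
have u0 : n0 F D *m (q *m z) = 0.
  apply/colP => r; rewrite [RHS]mxE; apply/eqP/negPn/negP => ne.
  have h1 : val r \in negs by apply: n0_supp ne; apply: pres_supp.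
  have h2 : val r \notin negs.
    have : supp Q2 (invmx p *m (p *m n0 F D *m q *m z)) by apply: pres_supp.
    by rewrite -!mulmxA mulKmx //; apply.
  by rewrite h1 in h2.
by rewrite -[z](mulKmx uq) -[q *m z](mulKmx un) u0 !mulmx0.
Qed.

Local Notation bas := (bas D F).
Local Notation Kr := (Kr D Ks F).

(** The coordinate at -al is K(e_al, .), and K(e_al, g^-1 theta g z) = K(g e_al, theta g z) has the
    factor K(g z, e_a0) by the rank one identity. *)
Lemma rank_one_block w (z : 'cV[F]_n) : roots_in D w -> supp Q1 z ->
  (gw D w *m z)^T *m Kr *m bas a0 = 0 ->
  supp Q2 (invmx (gw D w) *m xr a0 1 *m gw D w *m z).
Proof.
move=> win Qz lz r; apply: contraNN => /mapP[al alT rE].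
have [ug _] := gw_inv ok win; set g := gw D w in lz ug *.
have gK : g^T *m Kr *m g = Kr by apply: (gw_form_any ok fok).
have sK : size Ks = n by case/and3P: fok => /eqP.
have KgV : Kr *m invmx g = g^T *m Kr by rewrite -{1}gK mulmxK.
have Kal : (bas al)^T *m Kr = (bas (val r))^T.
  rewrite -(Kr_sym fok F) -trmx_mul smx_bas // (eqP (allP Kneg _ alT)) /= -rE.
  by [].
set y := _ *m z; have -> : y r 0 = ((bas (val r))^T *m y) 0 0.
  rewrite [RHS]mxE (bigD1 r) //= big1 => [|k ne]; rewrite !mxE scoef1.
    by rewrite eqxx !mul1r addr0.
  by rewrite eq_sym val_eqE (negPf ne) !mul0r.
rewrite -Kal /y -!mulmxA (mulmxA Kr) KgV !(mulmxA (bas al)^T) -trmx_mul.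
(* A row vector expressing the rank one identity; it vanishes on the basis of V, hence on z. *)
pose rho := (g *m bas al)^T *m Kr *m xr a0 1 *m g +
  ((g *m bas al)^T *m Kr *m bas a0) *m ((bas a0)^T *m Kr *m g).
have symm (u1 u2 : 'cV[F]_n) : u1^T *m Kr *m u2 = u2^T *m Kr *m u1.
  have tr1 (M : 'M[F]_1) : M^T = M by apply/matrixP => k l; rewrite !ord1 mxE.
  by rewrite -[LHS]trmxK tr1 !trmx_mul trmxK (Kr_sym fok) mulmxA.
have rho0 be : be \in tops -> rho *m bas be = 0.
  move=> beT; have := core_identity_any ok fok cok a0r topsr win alT beT.
  rewrite [(_ *m bas be)^T *m _ *m _]symm -/g -!mulmxA => C.
  by rewrite mulmxDl -!mulmxA C addNr.
have rhoz : rho *m z = 0.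
  apply/matrixP => k l; rewrite !ord1 [LHS]mxE [RHS]mxE big1 // => j _.
  have [->|/Qz /rho0/matrixP/(_ 0 0)] := eqVneq (z j 0) 0; first by rewrite mulr0.
  rewrite [LHS]mxE [RHS]mxE (bigD1 j) //= big1 => [|m ne]; rewrite [bas _ _ _]mxE scoef1.
    by rewrite eqxx [X in _ * X](_ : _ = 1) // mulr1 addr0 => ->; rewrite mul0r.
  by rewrite eq_sym val_eqE (negPf ne) mulr0.
move: rhoz; rewrite mulmxDl -[X in _ + X]mulmxA -[X in _ + _ *m X]mulmxA -[(bas a0)^T *m _ *m _]symm.
rewrite lz mulmx0 addr0 -!mulmxA => ->.
by rewrite mxE.
Qed.

Lemma not_Type_of_zero na0 N : scol Ks a0 = [:: (na0, N)] -> N%:~R = 0 :> F ->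
  tops != [::] -> ~ Type_of (xr a0 1) i.
Proof.
move=> Ka0 N0 nT /(Type_of_elim ok tok)[g [p [q [/(chev_word ok)[w win ->] pp pq E]]]].
have sK : size Ks = n by case/and3P: fok => /eqP.
have Kb : Kr *m bas a0 = 0.
  rewrite smx_bas // Ka0; apply/colP => r; rewrite !mxE scoef1 rmorphM.
  by rewrite [X in _ * X]N0 mulr0.
have [al alT] : exists al, al \in tops by case: tops nT => // al s _; exists al; apply: mem_head.
have Qb : supp Q1 (bas al).
  by move=> r; rewrite mxE scoef1; case: (al =P r) => [<-|]; rewrite ?mul0r ?eqxx.
have : bas al = 0.
  apply: (opposite_block pp pq Qb); rewrite -E; apply: rank_one_block => //.
  by rewrite -mulmxA Kb mulmx0.
have lal := ltn_ldim (allP topsr _ alT).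
by move/colP/(_ (Ordinal lal))/eqP; rewrite !mxE scoef1 eqxx oner_eq0.
Qed.

(** On the plane spanned by e_al and e_be the linear form K(g z, e_a0) has a nonzero kernel, where
    the block vanishes. *)
Lemma not_Type_of_rank al be : al \in tops -> be \in tops -> al != be -> ~ Type_of (xr a0 1) i.
Proof.
move=> alT beT ne /(Type_of_elim ok tok)[g [p [q [/(chev_word ok)[w win ->] pp pq E]]]].
pose la := ((gw D w *m bas al)^T *m Kr *m bas a0) 0 0.
pose lb := ((gw D w *m bas be)^T *m Kr *m bas a0) 0 0.
have key u v : u * la + v * lb = 0 -> u *: bas al + v *: bas be = 0.
  move=> uv; apply: (opposite_block pp pq).
    move=> r; rewrite !mxE !scoef1; case: (al =P r) => [<- //|_].
    by case: (be =P r) => [<- //|_]; rewrite !mul0r !mulr0 addr0 eqxx.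
  rewrite -E; apply: rank_one_block => //.
    move=> r; rewrite !mxE !scoef1; case: (al =P r) => [<- //|_].
    by case: (be =P r) => [<- //|_]; rewrite !mul0r !mulr0 addr0 eqxx.
  rewrite mulmxDr -!scalemxAr linearD /= !linearZ /= !mulmxDl -!scalemxAl.
  by apply/matrixP => r s; rewrite !ord1 [LHS]mxE [X in X + _]mxE [X in _ + X]mxE [RHS]mxE.
have bE c (r : 'I_n) : bas c r 0 = (c == r)%:R by rewrite mxE scoef1 mulr1; case: eqP.
have val2 u v (a b : nat) (lta : (a < n)%N) : a != b -> u *: bas a + v *: bas b = 0 -> u = 0.
  move=> nab /colP/(_ (Ordinal lta)); rewrite [LHS]mxE [X in X + _]mxE [X in _ + X]mxE [RHS]mxE.
  by rewrite !bE /= eqxx [b == a]eq_sym (negPf nab) mulr1 mulr0 addr0.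
have [lal lbe] := (ltn_ldim (allP topsr _ alT), ltn_ldim (allP topsr _ beT)).
(* The kernel vector (lb, -la) must vanish, so lb = 0; but then (0, 1) is a nonzero kernel
   vector. *)
have lb0 : lb = 0 by apply: (val2 lb (- la) al be lal ne); apply: key; rewrite mulrC mulNr subrr.
have : 1 *: bas be + 0 *: bas al = 0 by rewrite addrC; apply: key; rewrite lb0 mulr0 mul0r addr0.
by move/(val2 1 0 be al lbe); rewrite eq_sym => /(_ ne)/eqP; rewrite oner_eq0.
Qed.
End Opposite.

(** * The types F4 and G2 *)

(* The invariant form with (e_a, e_-a) = 1 for long roots a, hence 2 (F4) or 3 (G2) for short
   ones. *)
Definition formtab (D : rootdata) : smat :=
  let norm a := bilc D (rootv D a) (rootv D a) in
  let B i j := nth 0 (nth [::] (bform D) i) j in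
  let lg := foldr (fun x y : int => if x < y then y else x) 0
    [seq norm a | a <- iota 0 (nroots D)] in
  [seq [:: (neg D a, (lg %/ norm a)%Z)] | a <- iota 0 (nroots D)] ++
  [seq nform [seq ((nroots D + j)%N, ((2 * lg * B i j) %/ (B i i * B j j))%Z)
    | j <- iota 0 (rk D)] | i <- iota 0 (rk D)].

Local Notation "x[ a , c ]" := (a%N, c%R : int) (at level 0, a, c at level 99).

Definition wrs (D : rootdata) (s : int) (l : seq nat) : seq (seq (nat * int)) :=
  [seq wrword D s (simple D i) | i <- l].

(** * Computations for F4 *)

Lemma F4_tables_ok : tables_ok F4 (ads F4). Proof. by vm_compute. Qed.
Lemma F4_form_ok : form_ok F4 (ads F4) (formtab F4). Proof. by vm_compute. Qed.
Lemma F4_torus_ok : torus_ok F4 (ads F4) 3 44. Proof. by vm_compute. Qed.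
Lemma F4_short_ok : short_ok F4 (ads F4) 44. Proof. by vm_compute. Qed.

Lemma F4_form_short : scol (formtab F4) 44 = [:: x[20, 2]]. Proof. by vm_compute. Qed.

(* The columns are the roots whose alpha_i-coefficient is maximal. *)
Lemma F4_block_ok :
  [&& block_ok F4 (ads F4) (formtab F4) 44 0 [:: 23]%N,
      block_ok F4 (ads F4) (formtab F4) 44 1 [:: 23; 22]%N &
      block_ok F4 (ads F4) (formtab F4) 44 2 [:: 23; 22; 21]%N].
Proof. by vm_compute. Qed.

(* x_{-b}(1) = x_b(1) w_b(-1) x_b(1) for the highest short root b = 1232, and w_b(-1) differs
   from n0 by the longest element of the Weyl group of B3 and a torus element. *)
Lemma F4_cell3 : cell_ok F4 (ads F4) 3 [:: x[44, 1]] [:: [:: x[20, 1]]]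
  (wrs F4 1 [:: 0; 1; 0; 2; 1; 0; 2; 1; 2]%N ++ [:: hword F4 2; hword F4 3; [:: x[20, 1]]]).
Proof. by vm_compute. Qed.

(** 33 = -1110 and 44 = -1232 are short with sum 47 = -2342, the lowest root; -2 is their structure
    constant. *)
Lemma F4_comm : comm_ok F4 (ads F4) 33 44 47 (-2).
Proof. by vm_compute. Qed.

(** For r = 2342, x_{-r}(1) lies in U_r w_r U_r, and up to the torus w_r differs from n0 by the
    longest element of the Weyl group of C3. Commuting with x_a(1), a = -1110, brings in r + a =
    1232 and r + 2a = 0122. *)
Lemma F4_cell0 : cell_ok F4 (ads F4) 0 [:: x[47, 1]; x[33, 1]]
  [:: [:: x[23, 1]; x[20, 1]; x[13, 1]]]
  (wrs F4 1 [:: 1; 2; 1; 2; 3; 2; 1; 2; 3]%N ++ [:: [:: x[20, -1]; x[23, 1]]]).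
Proof. by vm_compute. Qed.

(** * Computations for G2 *)

Lemma G2_tables_ok : tables_ok G2 (ads G2). Proof. by vm_compute. Qed.
Lemma G2_form_ok : form_ok G2 (ads G2) (formtab G2). Proof. by vm_compute. Qed.
Lemma G2_torus_ok : torus_ok G2 (ads G2) 0 9. Proof. by vm_compute. Qed.
Lemma G2_short_ok : short_ok G2 (ads G2) 9. Proof. by vm_compute. Qed.
Lemma G2_form_short : scol (formtab G2) 9 = [:: x[3, 3]]. Proof. by vm_compute. Qed.
(** The cube of ad e_a is nonzero for short a in G2, so [core_ok] holds through its singleton
    clause. *)
Lemma G2_block_ok : block_ok G2 (ads G2) (formtab G2) 9 1 [:: 5]%N. Proof. by vm_compute. Qed.

(** The reflection in 2 alpha_1 + alpha_2 is w0 times that in the orthogonal root alpha_2. *)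
Lemma G2_cell0 : cell_ok G2 (ads G2) 0 [:: x[9, 1]] [:: [:: x[3, 1]]]
  (wrs G2 (-1) [:: 1]%N ++ [:: [:: x[3, 1]]]).
Proof. by vm_compute. Qed.

Lemma G2_comm : comm_ok G2 (ads G2) 8 9 11 3.
Proof. by vm_compute. Qed.

(** Here r = 3 alpha_1 + 2 alpha_2 is orthogonal to alpha_1. With a = -(alpha_1 + alpha_2), the
    roots 3, 1 and 4 are r + a, r + 2a and 2r + 3a. *)
Lemma G2_cell1 : cell_ok G2 (ads G2) 1 [:: x[11, 1]; x[8, 1]]
  [:: [:: x[5, 1]; x[3, -1]; x[1, 1]; x[4, -1]]]
  (wrs G2 (-1) [:: 0]%N ++ [:: [:: x[4, -1]; x[3, 1]; x[5, 1]]]).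
Proof. by vm_compute. Qed.

Lemma cellE D (i : 'I_(rk D)) k u ps qs : nat_of_ord i = k ->
  cell_ok D (ads D) k u ps qs -> cell_ok D (ads D) i u ps qs.
Proof. by move->. Qed.

Lemma blockE D K a0 (i : 'I_(rk D)) k tops : nat_of_ord i = k ->
  block_ok D (ads D) K a0 k tops -> block_ok D (ads D) K a0 i tops.
Proof. by move->. Qed.

Lemma F4_short_type (F : fieldType) (i : 'I_(rk F4)) :
  Type_of (xr F4 44 (1 : F)) i <->
  (if (2 \in [pchar F])%N then nat_of_ord i = 3%N
   else nat_of_ord i = 0%N \/ nat_of_ord i = 3%N).
Proof.
have := ltn_ord i; have [b0 b1 b2] := and3P F4_block_ok.
have c0 := F4_cell0; have c3 := F4_cell3; set P := Type_of _ _.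
have H0 : (2 \in [pchar F])%N -> nat_of_ord i = 0%N -> ~ P.
  move=> ch2 iE; have b := blockE iE b0.
  by apply: (not_Type_of_zero F4_tables_ok F4_torus_ok isT F4_form_ok isT b F4_form_short
               (pcharf0 ch2) isT).
have H0' : (2 \notin [pchar F])%N -> nat_of_ord i = 0%N -> P.
  move=> ch2 iE.
  apply: (Type_of_comm F4_tables_ok F4_torus_ok isT F4_short_ok isT isT F4_comm (cellE iE c0)).
  (* The constant -2 of [F4_comm] is nonzero in [F] exactly outside characteristic 2. *)
  by rewrite rmorphN oppr_eq0; apply: contraNneq ch2 => z; rewrite inE /=; apply/eqP.
have H1 : nat_of_ord i = 1%N -> ~ P.
  move=> iE; have b := blockE iE b1.
  by apply: (not_Type_of_rank F4_tables_ok F4_torus_ok isT F4_form_ok isT b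
               (al := 23) (be := 22) isT isT isT).
have H2 : nat_of_ord i = 2%N -> ~ P.
  move=> iE; have b := blockE iE b2.
  by apply: (not_Type_of_rank F4_tables_ok F4_torus_ok isT F4_form_ok isT b
               (al := 23) (be := 22) isT isT isT).
have H3 : nat_of_ord i = 3%N -> P.
  by move=> iE; apply: (Type_of_cell F4_tables_ok F4_torus_ok isT F (cellE iE c3)).
clear b0 b1 b2 c0 c3; clearbody P; move: H0 H0' H1 H2 H3.
case: (nat_of_ord i) => [|[|[|[|m]]]] // H0 H0' H1 H2 H3 _.
- case: (boolP (2 \in _)) => ch2; first by split=> // /(H0 ch2 erefl).
  by split=> _; [left | apply: H0'].
- by split=> [/(H1 erefl) //|]; case: ifP => // _ [].
- by split=> [/(H2 erefl) //|]; case: ifP => // _ [].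
by split=> _; [case: ifP => // _; right | apply: H3].
Qed.

Lemma G2_short_type (F : fieldType) (i : 'I_(rk G2)) :
  Type_of (xr G2 9 (1 : F)) i <->
  (if (3 \in [pchar F])%N then nat_of_ord i = 0%N else True).
Proof.
have := ltn_ord i; have b1 := G2_block_ok.
have c0 := G2_cell0; have c1 := G2_cell1; set P := Type_of _ _.
have H0 : nat_of_ord i = 0%N -> P.
  by move=> iE; apply: (Type_of_cell G2_tables_ok G2_torus_ok isT F (cellE iE c0)).
have H1 : (3 \in [pchar F])%N -> nat_of_ord i = 1%N -> ~ P.
  move=> ch3 iE; have b := blockE iE b1.
  by apply: (not_Type_of_zero G2_tables_ok G2_torus_ok isT G2_form_ok isT b G2_form_short
               (pcharf0 ch3) isT).
have H1' : (3 \notin [pchar F])%N -> nat_of_ord i = 1%N -> P.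
  move=> ch3 iE.
  apply: (Type_of_comm G2_tables_ok G2_torus_ok isT G2_short_ok isT isT G2_comm (cellE iE c1)).
  by apply: contraNneq ch3 => z; rewrite inE /=; apply/eqP.
clear b1 c0 c1; clearbody P; move: H0 H1 H1'.
case: (nat_of_ord i) => [|[|m]] // H0 H1 H1' _; first by split=> _; [case: ifP | apply: H0].
by case: (boolP (3 \in _)) => ch3; [split=> // /(H1 ch3 erefl) | split=> // _; apply: H1'].
Qed.

Theorem theorem2p9 :
  (forall (F : fieldType) (a : nat), short F4 a ->
   forall theta : 'M[F]_(ldim F4), rootsub a theta -> theta != 1%:M ->
   forall i : 'I_(rk F4),
     Type_of theta i <->
     (if (2 \in [pchar F])%N then nat_of_ord i = 3%N
      else nat_of_ord i = 0%N \/ nat_of_ord i = 3%N)) /\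
  (forall (F : fieldType) (a : nat), short G2 a ->
   forall theta : 'M[F]_(ldim G2), rootsub a theta -> theta != 1%:M ->
   forall i : 'I_(rk G2),
     Type_of theta i <->
     (if (3 \in [pchar F])%N then nat_of_ord i = 0%N else True)).
Proof.
split=> F a sa th tha th1 i.
  apply: iff_trans (F4_short_type F i).
  exact: (Type_of_short F4_tables_ok F4_torus_ok F4_short_ok isT isT i sa tha th1).
apply: iff_trans (G2_short_type F i).
exact: (Type_of_short G2_tables_ok G2_torus_ok G2_short_ok isT isT i sa tha th1).
Qed.
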